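(* Let $0<r<R<\infty$ and $\delta\in\mathbb{R}$. For any fixed $\nu\ge|\delta|$ and all sufficiently large $k$, the positive zeros $x''_{\nu,k}$ of $\mathfrak{h}_{\nu,\delta}$ satisfy $$x''_{\nu,k}=\frac{\pi}{R-r}k+O_\nu\left(\frac1k\right).$$
   Context: $J_\nu,Y_\nu$ are the Bessel functions of the first and second kind of order $\nu$; $j_\nu(x)=j_{\nu,\delta}(x):=x^{-\delta}J_\nu(x)$, $y_\nu(x)=y_{\nu,\delta}(x):=x^{-\delta}Y_\nu(x)$; and for $x>0$ $$\mathfrak{h}_{\nu,\delta}(x):=j_\nu'(Rx)y_\nu'(rx)-j_\nu'(rx)y_\nu'(Rx).$$ For $\nu\ge|\delta|$ the positive zeros of $\mathfrak{h}_{\nu,\delta}$ are simple; they are listed in increasing order as $x''_{\nu,k}$, with the index $k$ beginning with $k=0$ if $\nu>|\delta|$ and with $k=1$ if $\nu=|\delta|$. The implicit constant may also depend on $r,R,\delta$. *)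

(* Defs.v *)
From Stdlib Require Import Reals Factorial.
From Coquelicot Require Import Coquelicot.
Open Scope R_scope.

(* 1/Gamma(z) by Euler's limit z (z+1) ... (z+n) / (n! n^z). The limit exists
   for every real z, with value 0 at the poles 0, -1, -2, ... of Gamma. *)
Definition rgamma (z : R) : R :=
  real (Lim_seq (fun n : nat =>
    prod_f_R0 (fun k => z + INR k) n / (INR (fact n) * Rpower (INR n) z))).

(* Only used for x > 0: Rpower (x/2) nu is a junk value otherwise. *)
Definition besselJ (nu x : R) : R :=
  Rpower (x / 2) nu *
  PSeries (fun m => (-1) ^ m / INR (fact m) * rgamma (nu + INR m + 1))
          ((x / 2) ^ 2).

Definition besselY_formula (nu x : R) : R :=
  (besselJ nu x * cos (nu * PI) - besselJ (- nu) x) / sin (nu * PI).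

(* sin (nu * PI) = 0 exactly when nu is an integer. *)
Definition besselY (nu x : R) : R :=
  if Req_EM_T (sin (nu * PI)) 0
  then real (Lim (fun mu => besselY_formula mu x) nu)
  else besselY_formula nu x.

Definition jd (nu delta x : R) : R := Rpower x (- delta) * besselJ nu x.
Definition yd (nu delta x : R) : R := Rpower x (- delta) * besselY nu x.

(* The radii r < R are written rin < rout. *)
Definition hfrak (rin rout nu delta x : R) : R :=
  Derive (jd nu delta) (rout * x) * Derive (yd nu delta) (rin * x)
  - Derive (jd nu delta) (rin * x) * Derive (yd nu delta) (rout * x).

(* z k0 < z (k0+1) < ... are exactly the positive zeros of f; the values z k
   with k < k0 are irrelevant. *)
Definition lists_positive_zeros (f : R -> R) (k0 : nat) (z : nat -> R) : Prop :=
  (forall k, (k0 <= k)%nat -> z k < z (S k)) /\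
  (forall x, (0 < x /\ f x = 0) <-> exists k, (k0 <= k)%nat /\ z k = x).

Definition first_index (nu delta : R) : nat :=
  if Rlt_dec (Rabs delta) nu then 0%nat else 1%nat.

(* Main.v *)
Require Import Defs.
From Stdlib Require Import Reals Ranalysis5 ZArith Factorial Lra Lia Psatz ClassicalEpsilon.
From Coquelicot Require Import Coquelicot.
Open Scope R_scope.

(** Write [v f = f' - (delta / t) f], so that [(t^-delta f)' = t^-delta v f]. The zeros of
    [hfrak] do not change when (J, Y) is replaced by another basis (u1, u2) of solutions of
    Bessel's equation; take the basis with [sqrt t u1 ~ cos t] and [sqrt t u2 ~ sin t]. Let
    theta be a continuous argument of the plane curve (v u1, v u2). Then [hfrak] vanishes at x
    iff D(x) = theta(R x) - theta(r x) is a multiple of PI. At such an x some solution u has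
    v u = 0 at both r x and R x, and monotonicity of t^2 u'^2 + (t^2 - nu^2) u^2 gives
    D'(x) > 0, so D crosses every level k PI at most once, upwards. Near 0 the function v J
    does not vanish, hence |D| < PI there, and the sign of theta', which is that of
    t^2 - (nu^2 - delta^2), shows that the first level crossed is 0 if nu > |delta| and PI if
    nu = |delta|. Finally theta(t) = t + const + O(1/t), so D(x) = (R - r) x + O(1/x). *)

(** * The reciprocal Gamma function *)

(** Only two properties of the concrete pair (J, Y) enter the phase argument: its Wronskian is
    nonzero, and [v J] has no zero near 0. The obstacle is Y of integer order, a limit in the order:
    it contains the derivative of Bessel's series in [nu], so that series has to be differentiated
    term by term. Since 1/Gamma is given only as Euler's limit, it is expanded to second order at
    each integer, with an error that grows at most geometrically along the integers; the factorials
    in the series absorb this growth. The amplitudes of J and Y at infinity stay abstract: passing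
    to the basis with leading terms cos and sin is possible because the determinant of the
    amplitudes equals the Wronskian. Positivity of D' is established only where sin D = 0; this
    makes each level a one-way barrier, which is all that counting needs. The index is exact because
    the position of D among the levels near 0 is known and the constant in the expansion of theta
    cancels in D. *)

Lemma ln_one_plus_bound (t : R) : - (1 / 2) <= t -> Rabs (ln (1 + t) - t) <= 2 * t ^ 2.
Proof.
  intros Ht.
  assert (H1 : ln (1 + t) <= t).
  { rewrite <- (ln_exp t) at 2. apply ln_le; [lra|]. apply exp_ineq1_le. }
  assert (H2 : ln (/ (1 + t)) <= / (1 + t) - 1).
  { rewrite <- (ln_exp (/ (1 + t) - 1)). apply ln_le.
    - apply Rinv_0_lt_compat; lra.
    - generalize (exp_ineq1_le (/ (1 + t) - 1)); lra. }
  rewrite ln_Rinv in H2 by lra.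
  assert (H3 : t - (1 - / (1 + t)) <= 2 * t ^ 2).
  { replace (t - (1 - / (1 + t))) with (t ^ 2 * / (1 + t)) by (field; lra).
    assert (/ (1 + t) <= 2).
    { replace 2 with (/ (1 / 2)) by field. apply Rinv_le_contravar; lra. }
    nra. }
  rewrite Rabs_left1; lra.
Qed.

Lemma ex_series_Rabs_le (a b : nat -> R) :
  (forall n, Rabs (a n) <= b n) -> ex_series b -> ex_series a.
Proof. apply (ex_series_le (K := R_AbsRing) (V := R_CompleteNormedModule)). Qed.

(** Comparison with the telescoping series of [2 / ((k + 1) (k + 2))]. *)
Lemma ex_series_inv_sqr : ex_series (fun k : nat => / (INR k + 1) ^ 2).
Proof.
  assert (Ht : is_series (fun k : nat => 2 * (/ (INR k + 1) - / (INR k + 2))) (2 * 1)).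
  { apply (is_series_scal 2 (fun k : nat => / (INR k + 1) - / (INR k + 2)) 1).
    change (is_lim_seq (sum_n (fun k : nat => / (INR k + 1) - / (INR k + 2))) 1).
    apply (is_lim_seq_ext (fun n => 1 - / (INR n + 2))).
    - intros n. induction n as [|n IH].
      + rewrite sum_O. simpl. field.
      + rewrite sum_Sn, <- IH, S_INR. unfold plus; simpl.
        pose proof (pos_INR n). field. lra.
    - replace (Finite 1) with (Rbar_minus 1 0) by (simpl; f_equal; ring).
      apply is_lim_seq_minus'; [apply is_lim_seq_const|].
      apply (is_lim_seq_inv (fun n => INR n + 2) p_infty); [|easy].
      eapply is_lim_seq_plus; [apply is_lim_seq_INR|apply is_lim_seq_const|easy]. }
  apply (ex_series_Rabs_le _ (fun k : nat => 2 * (/ (INR k + 1) - / (INR k + 2)))).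
  - intros n. pose proof (pos_INR n) as Hn.
    assert (0 < / (INR n + 1)) by (apply Rinv_0_lt_compat; lra).
    assert (0 < / (INR n + 2)) by (apply Rinv_0_lt_compat; lra).
    rewrite Rabs_pos_eq by (left; apply Rinv_0_lt_compat; nra).
    apply Rminus_le.
    replace (/ (INR n + 1) ^ 2 - 2 * (/ (INR n + 1) - / (INR n + 2)))
      with (- INR n * (/ (INR n + 1) * / (INR n + 1) * / (INR n + 2))) by (field; lra).
    assert (0 < / (INR n + 1) * / (INR n + 1) * / (INR n + 2)).
    { repeat apply Rmult_lt_0_compat; assumption. }
    nra.
  - eexists; exact Ht.
Qed.

(** Logarithms of the factors in Weierstrass's product [1/Gamma(1+z) = exp(gamma z) prod (1 + z/k)
    exp(-z/k)], with [k] shifted to start at 0. The series of [euler_term] sums to Euler's constant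
    gamma. *)
Definition lgamma_rem (z : R) (k : nat) : R := ln (1 + z / (INR k + 1)) - z / (INR k + 1).
Definition euler_term (k : nat) : R := / (INR k + 1) - ln (1 + / (INR k + 1)).

Lemma inv_succ_bound (k : nat) : 0 < / (INR k + 1) <= 1.
Proof.
  pose proof (pos_INR k). split.
  - apply Rinv_0_lt_compat; lra.
  - rewrite <- Rinv_1. apply Rinv_le_contravar; lra.
Qed.

Lemma lgamma_rem_bound (z : R) (k : nat) :
  - (1 / 2) <= z -> Rabs (lgamma_rem z k) <= 2 * z ^ 2 * / (INR k + 1) ^ 2.
Proof.
  intros Hz. pose proof (inv_succ_bound k). unfold lgamma_rem.
  replace (2 * z ^ 2 * / (INR k + 1) ^ 2) with (2 * (z / (INR k + 1)) ^ 2)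
    by (pose proof (pos_INR k); field; lra).
  apply ln_one_plus_bound. unfold Rdiv. nra.
Qed.

Lemma euler_term_bound (k : nat) : Rabs (euler_term k) <= 2 * / (INR k + 1) ^ 2.
Proof.
  pose proof (inv_succ_bound k). unfold euler_term. rewrite Rabs_minus_sym.
  rewrite <- pow_inv. apply ln_one_plus_bound. lra.
Qed.

Lemma ex_series_lgamma_rem (z : R) : - (1 / 2) <= z -> ex_series (lgamma_rem z).
Proof.
  intros Hz. apply (ex_series_Rabs_le _ (fun k => 2 * z ^ 2 * / (INR k + 1) ^ 2)).
  - intros k. now apply lgamma_rem_bound.
  - apply (ex_series_scal_l (K := R_AbsRing) (V := R_NormedModule) (2 * z ^ 2)). apply ex_series_inv_sqr.
Qed.

Lemma ex_series_euler_term : ex_series euler_term.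
Proof.
  apply (ex_series_Rabs_le _ (fun k => 2 * / (INR k + 1) ^ 2)).
  - apply euler_term_bound.
  - apply (ex_series_scal_l (K := R_AbsRing) (V := R_NormedModule) 2). apply ex_series_inv_sqr.
Qed.

Definition euler_seq (z : R) (n : nat) : R :=
  prod_f_R0 (fun k => z + INR k) n / (INR (fact n) * Rpower (INR n) z).

Lemma prod_f_R0_S (f : nat -> R) (n : nat) : prod_f_R0 f (S n) = prod_f_R0 f n * f (S n).
Proof. reflexivity. Qed.

(** Passage from Euler's product to Weierstrass's. The terms [z / (k + 1)] cancel between the two
    sums, and the logarithms in [euler_term] telescope to [ln (n + 2)]. The bound on [z] keeps every
    factor positive. *)
Lemma euler_prod_exp (z : R) (n : nat) : - (1 / 2) <= z ->
  prod_f_R0 (fun k => 1 + z + INR k) n =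
  INR (fact (S n)) *
  exp (sum_n (lgamma_rem z) n + z * sum_n euler_term n + z * ln (INR n + 2)).
Proof.
  intros Hz.
  assert (Hk : forall k, 0 < 1 + z + INR k) by (intros k; pose proof (pos_INR k); lra).
  assert (Hq : forall k, 1 + z / (INR k + 1) = (1 + z + INR k) * / (INR k + 1)).
  { intros k; pose proof (pos_INR k); field; lra. }
  assert (Hl : forall k, ln (1 + z / (INR k + 1)) = ln (1 + z + INR k) - ln (INR k + 1)).
  { intros k; pose proof (inv_succ_bound k); pose proof (pos_INR k).
    rewrite Hq, ln_mult, ln_Rinv; try lra; auto. }
  assert (He : forall k, ln (1 + / (INR k + 1)) = ln (INR k + 2) - ln (INR k + 1)).
  { intros k; pose proof (inv_succ_bound k); pose proof (pos_INR k).
    replace (1 + / (INR k + 1)) with ((INR k + 2) * / (INR k + 1)) by (field; lra).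
    rewrite ln_mult, ln_Rinv; lra. }
  induction n as [|n IH].
  - rewrite !sum_O. unfold lgamma_rem, euler_term. rewrite Hl, He. simpl fact.
    change (prod_f_R0 (fun k => 1 + z + INR k) 0) with (1 + z + INR 0).
    simpl (INR 1). rewrite Rmult_1_l.
    match goal with |- _ = exp ?e => replace e with (ln (1 + z + INR 0)) end.
    + rewrite exp_ln; auto.
    + simpl (INR 0). replace (0 + 1) with 1 by ring. rewrite ln_1. field.
  - rewrite prod_f_R0_S, IH, !sum_Sn. unfold plus; simpl plus.
    rewrite (fact_simpl (S n)), mult_INR.
    match goal with |- _ * exp ?a * _ = _ * exp ?b =>
      replace b with (a + ln (1 + z + INR (S n)) - ln (INR (S n) + 1)) end.
    + match goal with |- _ * exp ?a * _ = _ => generalize a; intros a' end.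
      unfold Rminus. rewrite exp_plus, exp_plus, exp_Ropp, !exp_ln; auto.
      * rewrite !S_INR. pose proof (pos_INR n). field. lra.
      * pose proof (pos_INR (S n)); lra.
    + unfold lgamma_rem, euler_term. rewrite Hl, He, S_INR.
      simpl plus. replace (INR n + 1 + 1) with (INR n + 2) by ring.
      pose proof (pos_INR n). unfold plus; simpl. field. lra.
Qed.

Lemma is_lim_seq_ln_shift (a : R) : 0 <= a ->
  is_lim_seq (fun n => ln (INR n + a) - ln (INR n)) 0.
Proof.
  intros Ha. rewrite <- ln_1.
  apply (is_lim_seq_ext_loc (fun n => ln (1 + a * / INR n))).
  - exists 1%nat. intros n Hn. apply (le_INR 1) in Hn. simpl in Hn.
    rewrite <- ln_div by lra. f_equal. field. lra.
  - apply (is_lim_seq_continuous ln).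
    + apply derivable_continuous_pt. exists (/ 1). apply derivable_pt_lim_ln; lra.
    + replace (Finite 1) with (Finite (1 + a * 0)) by (f_equal; ring).
      apply is_lim_seq_plus'; [apply is_lim_seq_const|].
      apply is_lim_seq_mult'; [apply is_lim_seq_const|].
      apply (is_lim_seq_inv INR p_infty); [apply is_lim_seq_INR|easy].
Qed.

Lemma is_lim_euler_seq_pos (z : R) : - (1 / 2) <= z ->
  is_lim_seq (euler_seq (1 + z)) (exp (Series (lgamma_rem z) + z * Series euler_term)).
Proof.
  intros Hz.
  apply (is_lim_seq_ext_loc (fun n => exp ((ln (INR n + 1) - ln (INR n)) +
     (sum_n (lgamma_rem z) n + z * sum_n euler_term n) + z * (ln (INR n + 2) - ln (INR n))))).
  - exists 1%nat. intros n Hn. apply (le_INR 1) in Hn. simpl in Hn.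
    unfold euler_seq. rewrite euler_prod_exp by assumption. unfold Rpower.
    rewrite fact_simpl, mult_INR, S_INR.
    pose proof (INR_fact_neq_0 n).
    transitivity ((INR n + 1) * exp (- ((1 + z) * ln (INR n))) *
      exp (sum_n (lgamma_rem z) n + z * sum_n euler_term n + z * ln (INR n + 2))).
    + rewrite <- (exp_ln (INR n + 1)) at 2 by lra.
      rewrite <- !exp_plus. f_equal. ring.
    + rewrite exp_Ropp. field. split; [apply Rgt_not_eq, exp_pos|easy].
  - apply (is_lim_seq_continuous exp).
    { apply derivable_continuous_pt, derivable_pt_exp. }
    replace (Series (lgamma_rem z) + z * Series euler_term)
      with (0 + (Series (lgamma_rem z) + z * Series euler_term) + z * 0) by ring.
    apply is_lim_seq_plus'; [apply is_lim_seq_plus'|].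
    + apply is_lim_seq_ln_shift; lra.
    + apply is_lim_seq_plus'.
      * apply (Series_correct _ (ex_series_lgamma_rem z Hz)).
      * apply is_lim_seq_mult'; [apply is_lim_seq_const|].
        apply (Series_correct _ ex_series_euler_term).
    + apply is_lim_seq_mult'; [apply is_lim_seq_const|].
      apply is_lim_seq_ln_shift; lra.
Qed.

Lemma prod_f_R0_shift (z : R) (n : nat) :
  prod_f_R0 (fun k => z + INR k) (S n) = z * prod_f_R0 (fun k => z + 1 + INR k) n.
Proof.
  induction n as [|n IH].
  - simpl. ring.
  - rewrite prod_f_R0_S, IH, prod_f_R0_S, !S_INR. ring.
Qed.

(** The functional equation of Gamma before the limit: the ratio of the two sequences is
    [z n / (z + 1 + n)], which tends to [z]. It carries convergence from the half-line to all real
    arguments. *)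
Lemma euler_seq_step (z l : R) :
  is_lim_seq (euler_seq (z + 1)) l -> is_lim_seq (euler_seq z) (z * l).
Proof.
  intros H.
  apply (is_lim_seq_ext_loc (fun n => z * euler_seq (z + 1) n * / (1 + (z + 1) * / INR n))).
  (* Once [n > |z| + 1], the denominator [z + 1 + n] is nonzero. *)
  - destruct (nfloor_ex (Rabs z + 1)) as [N [HN1 HN2]].
    { pose proof (Rabs_pos z); lra. }
    exists (S (S N)). intros n Hn. apply le_INR in Hn. rewrite !S_INR in Hn.
    assert (HN : Rabs z + 1 < INR n) by lra.
    assert (Hz := Rabs_def2 z (INR n - 1)). destruct Hz as [Hz1 Hz2]; [lra|].
    pose proof (Rabs_pos z). unfold euler_seq.
    assert (E : (z + 1 + INR n) * prod_f_R0 (fun k => z + INR k) n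
            = z * prod_f_R0 (fun k => z + 1 + INR k) n).
    { rewrite <- prod_f_R0_shift, prod_f_R0_S, S_INR. ring. }
    rewrite Rpower_plus, Rpower_1 by lra.
    assert (Hp : Rpower (INR n) z <> 0) by (apply Rgt_not_eq, exp_pos).
    pose proof (INR_fact_neq_0 n).
    replace (prod_f_R0 (fun k => z + INR k) n)
      with (z * prod_f_R0 (fun k => z + 1 + INR k) n / (z + 1 + INR n))
      by (rewrite <- E; field; lra).
    field. repeat split; try assumption; lra.
  - replace (Finite (z * l)) with (Finite (z * l * / (1 + (z + 1) * 0)))
      by (f_equal; field).
    apply is_lim_seq_mult'; [apply is_lim_seq_mult'; [apply is_lim_seq_const|easy]|].
    apply (is_lim_seq_inv _ (Finite (1 + (z + 1) * 0))).
    + apply is_lim_seq_plus'; [apply is_lim_seq_const|].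
      apply is_lim_seq_mult'; [apply is_lim_seq_const|].
      apply (is_lim_seq_inv INR p_infty); [apply is_lim_seq_INR|easy].
    + intros H'. injection H'. lra.
Qed.

Lemma rgamma_unique (z l : R) : is_lim_seq (euler_seq z) l -> rgamma z = l.
Proof. intros H. unfold rgamma. apply is_lim_seq_unique in H. unfold euler_seq in H. now rewrite H. Qed.

(* Reduces a property of all reals to the half-line on which Euler's product is estimated. *)
Lemma down_induction (P : R -> Prop) :
  (forall z, 1 / 2 <= z -> P z) -> (forall z, P (z + 1) -> P z) -> forall z, P z.
Proof.
  intros H0 Hs z.
  destruct (nfloor_ex (Rabs z + 1)) as [N [HN1 HN2]].
  { pose proof (Rabs_pos z); lra. }
  assert (Hz : 1 / 2 <= z + INR (S N)).
  { rewrite S_INR. pose proof (Rle_abs (- z)). rewrite Rabs_Ropp in H. lra. }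
  clear HN1 HN2. revert z Hz. induction (S N) as [|n IH]; intros z Hz.
  - apply H0. simpl in Hz. lra.
  - apply Hs, IH. rewrite S_INR in Hz. lra.
Qed.

Lemma is_lim_euler_seq (z : R) : is_lim_seq (euler_seq z) (rgamma z).
Proof.
  assert (H : exists l : R, is_lim_seq (euler_seq z) l).
  { revert z. apply down_induction.
    - intros z Hz. replace z with (1 + (z - 1)) by ring.
      eexists. apply is_lim_euler_seq_pos. lra.
    - intros z [l Hl]. exists (z * l). now apply euler_seq_step. }
  destruct H as [l Hl]. now rewrite (rgamma_unique _ _ Hl).
Qed.

Lemma rgamma_rec (z : R) : rgamma z = z * rgamma (z + 1).
Proof. apply rgamma_unique, euler_seq_step, is_lim_euler_seq. Qed.

Lemma rgamma_one_plus (z : R) : - (1 / 2) <= z ->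
  rgamma (1 + z) = exp (Series (lgamma_rem z) + z * Series euler_term).
Proof. intros Hz. now apply rgamma_unique, is_lim_euler_seq_pos. Qed.

Lemma rgamma_pos (z : R) : 1 / 2 <= z -> 0 < rgamma z.
Proof.
  intros Hz. replace z with (1 + (z - 1)) by ring. rewrite rgamma_one_plus by lra.
  apply exp_pos.
Qed.

Lemma rgamma_neq_0 (z : R) : (forall k : nat, z <> - INR k) -> rgamma z <> 0.
Proof.
  revert z. apply (down_induction (fun z => (forall k : nat, z <> - INR k) -> rgamma z <> 0)).
  - intros z Hz _. now apply Rgt_not_eq, rgamma_pos.
  - intros z IH Hz. rewrite rgamma_rec. apply Rmult_integral_contrapositive_currified.
    + intros H0. apply (Hz 0%nat). simpl. lra.
    + apply IH. intros k Hk. apply (Hz (S k)). rewrite S_INR. lra.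
Qed.

Lemma Rabs_Series_le (a b : nat -> R) :
  (forall n, Rabs (a n) <= b n) -> ex_series b -> Rabs (Series a) <= Series b.
Proof.
  intros H Hb.
  assert (Ha : ex_series (fun n => Rabs (a n))).
  { apply (ex_series_Rabs_le _ b); [|easy]. intros n.
    now rewrite Rabs_Rabsolu. }
  eapply Rle_trans; [now apply Series_Rabs|].
  apply Series_le; [|easy]. intros n; split; [apply Rabs_pos|easy].
Qed.

Lemma rgamma_1 : rgamma 1 = 1.
Proof.
  replace 1 with (1 + 0) at 1 by ring. rewrite rgamma_one_plus by lra.
  rewrite (Series_ext _ (fun n => 0 * 0)).
  - rewrite Series_scal_l. rewrite <- exp_0. f_equal. ring.
  - intros n. unfold lgamma_rem, Rdiv. rewrite Rmult_0_l, Rplus_0_r, ln_1. ring.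
Qed.

(** * Second-order expansion of 1/Gamma at the integers *)

Lemma exp_taylor1 (l : R) : Rabs (exp l - 1 - l) <= l ^ 2 * exp (Rabs l).
Proof.
  pose proof (exp_ineq1_le l). pose proof (exp_ineq1_le (- l)).
  assert (H1 : exp l - 1 <= l * exp l).
  { rewrite exp_Ropp in H0. pose proof (exp_pos l).
    apply (Rmult_le_compat_r (exp l)) in H0; [|lra].
    rewrite Rinv_l in H0 by lra. lra. }
  rewrite Rabs_pos_eq by lra.
  apply Rle_trans with (l * (exp l - 1)); [lra|].
  destruct (Rle_dec 0 l) as [Hl|Hl].
  - rewrite (Rabs_pos_eq l) by easy. nra.
  - rewrite (Rabs_left l) by lra. assert (1 <= exp (- l)) by lra.
    assert (l * (exp l - 1) <= l * l) by nra. nra.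
Qed.

(* A quadratic error term, uniform in [h], survives summation over the terms of
   Bessel's series, so it is what gives differentiability in the order. *)
Definition quad_expansion (f : R -> R) (p d B : R) : Prop :=
  Rabs (f p) <= B /\ Rabs d <= B /\
  forall h, Rabs h <= 1 / 2 -> Rabs (f (p + h) - f p - h * d) <= B * h ^ 2.

(** In Weierstrass's form the logarithm of [1/Gamma(1+h)] is [h gamma + O(h^2)], so the derivative
    at 1 is Euler's constant. *)
Lemma rgamma_expansion_1 : exists d B, quad_expansion rgamma 1 d B.
Proof.
  set (g := Series euler_term).
  set (S2 := Series (fun k : nat => / (INR k + 1) ^ 2)).
  assert (HS2 : 0 <= S2).
  { eapply Rle_trans; [apply Rabs_pos|]. apply (Rabs_Series_le (fun _ => 0)).
    - intros n. rewrite Rabs_R0. pose proof (inv_succ_bound n).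
      rewrite <- pow_inv. apply pow2_ge_0.
    - apply ex_series_inv_sqr. }
  pose proof (Rabs_pos g) as Hg.
  (* For [|h| <= 1/2] the whole exponent is at most [|h| L], because its quadratic part [2 h^2 S2]
     is at most [2 |h| S2]. *)
  set (L := Rabs g + 2 * S2).
  exists g, (1 + Rabs g + (L ^ 2 * exp L + 2 * S2)).
  assert (HL : 0 <= L ^ 2 * exp L).
  { apply Rmult_le_pos; [apply pow2_ge_0|left; apply exp_pos]. }
  split; [|split].
  - rewrite rgamma_1, Rabs_R1. lra.
  - lra.
  - intros h Hh. pose proof (proj1 (Rabs_le_between h (1 / 2)) Hh) as [Hh1 Hh2].
    rewrite rgamma_one_plus, rgamma_1 by lra. fold g.
    set (s := Series (lgamma_rem h)).
    assert (Hs : Rabs s <= 2 * h ^ 2 * S2).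
    { unfold S2. rewrite <- Series_scal_l. apply Rabs_Series_le.
      - intros n. apply lgamma_rem_bound. lra.
      - apply (ex_series_scal_l (K := R_AbsRing) (V := R_NormedModule) (2 * h ^ 2)). apply ex_series_inv_sqr. }
    assert (Hl : Rabs (s + h * g) <= Rabs h * L).
    { eapply Rle_trans; [apply Rabs_triang|]. rewrite Rabs_mult. unfold L.
      assert (h ^ 2 <= Rabs h). { rewrite <- pow2_abs. pose proof (Rabs_pos h). nra. }
      nra. }
    assert (HLp : 0 <= L) by (unfold L; lra).
    pose proof (Rabs_pos h) as Hhp.
    assert (He : exp (Rabs (s + h * g)) <= exp L).
    { destruct (Rle_lt_or_eq_dec (Rabs (s + h * g)) L) as [Hlt| ->].
      - nra. - left; now apply exp_increasing. - lra. }
    assert (Hq : (s + h * g) ^ 2 <= h ^ 2 * L ^ 2).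
    { rewrite <- (pow2_abs (s + h * g)), <- (pow2_abs h), <- Rpow_mult_distr.
      apply pow_incr. split; [apply Rabs_pos|easy]. }
    pose proof (exp_taylor1 (s + h * g)) as Ht.
    replace (exp (s + h * g) - 1 - h * g) with ((exp (s + h * g) - 1 - (s + h * g)) + s) by ring.
    eapply Rle_trans; [apply Rabs_triang|].
    pose proof (pow2_ge_0 h). pose proof (exp_pos (Rabs (s + h * g))).
    pose proof (pow2_ge_0 (s + h * g)).
    assert ((s + h * g) ^ 2 * exp (Rabs (s + h * g)) <= h ^ 2 * L ^ 2 * exp L).
    { apply Rmult_le_compat; lra. }
    nra.
Qed.

Lemma quad_expansion_le (f : R -> R) (p d B C : R) :
  B <= C -> quad_expansion f p d B -> quad_expansion f p d C.
Proof.
  intros HBC (H1 & H2 & H3). repeat split; try lra.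
  intros h Hh. eapply Rle_trans; [now apply H3|].
  apply Rmult_le_compat_r; [apply pow2_ge_0|easy].
Qed.

Lemma quad_expansion_is_derive (f : R -> R) (p d B : R) :
  quad_expansion f p d B -> is_derive f p d.
Proof.
  intros (H1 & H2 & H3).
  assert (HB : 0 <= B) by (eapply Rle_trans; [apply Rabs_pos|exact H2]).
  apply is_derive_Reals. intros eps Heps.
  assert (Hd : 0 < Rmin (1 / 2) (eps / (B + 1))).
  { apply Rmin_glb_lt; [lra|]. apply Rdiv_lt_0_compat; lra. }
  exists (mkposreal _ Hd). simpl. intros h Hh0 Hh.
  assert (Ha : Rabs h <= 1 / 2) by (pose proof (Rmin_l (1 / 2) (eps / (B + 1))); lra).
  assert (Hb : Rabs h < eps / (B + 1)) by (pose proof (Rmin_r (1 / 2) (eps / (B + 1))); lra).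
  assert (Hhp : 0 < Rabs h) by now apply Rabs_pos_lt.
  replace ((f (p + h) - f p) / h - d) with ((f (p + h) - f p - h * d) / h) by (now field).
  rewrite Rabs_div by easy.
  apply Rle_lt_trans with (B * Rabs h).
  - apply Rle_div_l; [easy|]. rewrite Rmult_assoc.
    replace (Rabs h * Rabs h) with (h ^ 2) by (rewrite <- pow2_abs; ring). auto.
  - apply Rle_lt_trans with ((B + 1) * Rabs h); [nra|].
    apply (Rmult_lt_compat_r (B + 1)) in Hb; [|lra].
    unfold Rdiv in Hb. rewrite Rmult_assoc, Rinv_l in Hb by lra. lra.
Qed.

(** The new derivative is the quotient rule for [1/Gamma(p+1) = (1/Gamma(p)) / p]. The factor 6 has
    two sources: the remainder consists of three terms of size [B h^2], and division by
    [p + h >= 1/2] at most doubles it. *)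
Lemma rgamma_expansion_up (p d B : R) :
  1 <= p -> quad_expansion rgamma p d B ->
  quad_expansion rgamma (p + 1) (d / p - rgamma p / p ^ 2) (6 * B).
Proof.
  intros Hp (H1 & H2 & H3).
  assert (HB : 0 <= B) by (eapply Rle_trans; [apply Rabs_pos|exact H2]).
  assert (Hq : forall x y, 1 / 2 <= y -> Rabs (x / y) <= 2 * Rabs x).
  { intros x y Hy. unfold Rdiv. rewrite Rabs_mult, Rmult_comm.
    apply Rmult_le_compat_r; [apply Rabs_pos|].
    rewrite Rabs_pos_eq by (left; apply Rinv_0_lt_compat; lra).
    replace 2 with (/ (1 / 2)) by field. apply Rinv_le_contravar; lra. }
  assert (Hs : forall x y, 1 <= y -> Rabs (x / y) <= Rabs x).
  { intros x y Hy. unfold Rdiv. rewrite Rabs_mult. rewrite <- (Rmult_1_r (Rabs x)) at 2.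
    apply Rmult_le_compat_l; [apply Rabs_pos|].
    rewrite Rabs_pos_eq by (left; apply Rinv_0_lt_compat; lra).
    rewrite <- Rinv_1. apply Rinv_le_contravar; lra. }
  assert (E : forall h, Rabs h <= 1 / 2 -> rgamma (p + 1 + h) = rgamma (p + h) / (p + h)).
  { intros h Hh. apply Rabs_le_between in Hh. rewrite (rgamma_rec (p + h)).
    replace (p + h + 1) with (p + 1 + h) by ring. field. lra. }
  assert (E0 : rgamma (p + 1) = rgamma p / p).
  { rewrite (rgamma_rec p). field. lra. }
  split; [|split].
  - rewrite E0. eapply Rle_trans; [apply Hs; lra|]. lra.
  - eapply Rle_trans; [apply Rabs_triang|]. rewrite Rabs_Ropp.
    pose proof (Hs d p Hp). pose proof (Hs (rgamma p) (p ^ 2) ltac:(nra)). lra.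
  - intros h Hh. rewrite E, E0 by easy. specialize (H3 h Hh).
    apply Rabs_le_between in Hh.
    set (e := rgamma (p + h) - rgamma p - h * d) in *.
    replace (rgamma (p + h)) with (rgamma p + h * d + e) by (unfold e; ring).
    replace ((rgamma p + h * d + e) / (p + h) - rgamma p / p - h * (d / p - rgamma p / p ^ 2))
      with ((e + (h ^ 2 * (rgamma p / p ^ 2) - h ^ 2 * (d / p))) / (p + h)) by (field; lra).
    eapply Rle_trans; [apply Hq; lra|].
    assert (Rabs (e + (h ^ 2 * (rgamma p / p ^ 2) - h ^ 2 * (d / p))) <= 3 * B * h ^ 2);
      [|lra].
    eapply Rle_trans; [apply Rabs_triang|].
    assert (Rabs (h ^ 2 * (rgamma p / p ^ 2) - h ^ 2 * (d / p)) <= 2 * B * h ^ 2); [|lra].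
    rewrite <- Rmult_minus_distr_l, Rabs_mult, Rabs_pos_eq by apply pow2_ge_0.
    assert (Rabs (rgamma p / p ^ 2 - d / p) <= 2 * B).
    { eapply Rle_trans; [apply Rabs_triang|]. rewrite Rabs_Ropp.
      pose proof (Hs d p Hp). pose proof (Hs (rgamma p) (p ^ 2) ltac:(nra)). lra. }
    pose proof (pow2_ge_0 h). nra.
Qed.

(** Multiplication by the argument, hence the product rule. This step reaches the poles of Gamma,
    where division by [p] is impossible. *)
Lemma rgamma_expansion_down (p d B : R) :
  quad_expansion rgamma (p + 1) d B ->
  quad_expansion rgamma p (p * d + rgamma (p + 1)) ((Rabs p + 2) * B).
Proof.
  intros (H1 & H2 & H3).
  assert (HB : 0 <= B) by (eapply Rle_trans; [apply Rabs_pos|exact H2]).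
  pose proof (Rabs_pos p) as Hp.
  assert (Hm : forall x, Rabs x <= B -> Rabs (p * x) <= Rabs p * B).
  { intros x Hx. rewrite Rabs_mult. now apply Rmult_le_compat_l. }
  split; [|split].
  - rewrite rgamma_rec. apply Hm in H1. lra.
  - eapply Rle_trans; [apply Rabs_triang|]. apply Hm in H2. lra.
  - intros h Hh. specialize (H3 h Hh). rewrite (rgamma_rec (p + h)), (rgamma_rec p).
    replace (p + h + 1) with (p + 1 + h) by ring.
    set (e := rgamma (p + 1 + h) - rgamma (p + 1) - h * d) in *.
    replace (rgamma (p + 1 + h)) with (rgamma (p + 1) + h * d + e) by (unfold e; ring).
    match goal with |- Rabs ?x <= _ => replace x with ((p + h) * e + h ^ 2 * d) by ring end.
    eapply Rle_trans; [apply Rabs_triang|]. rewrite !Rabs_mult.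
    rewrite (Rabs_pos_eq (h ^ 2)) by apply pow2_ge_0.
    assert (Rabs (p + h) <= Rabs p + 1) by (pose proof (Rabs_triang p h); lra).
    assert (Rabs (p + h) * Rabs e <= (Rabs p + 1) * (B * h ^ 2)).
    { apply Rmult_le_compat; try apply Rabs_pos; lra. }
    pose proof (pow2_ge_0 h). nra.
Qed.

(** One constant [B] serves the whole progression starting at [1 - j]. Raising [j] by one adds a
    single new first argument, reached by one downward step; the others are those of the previous
    progression. *)
Lemma rgamma_expansion_nat (j : nat) :
  exists B, forall m : nat, exists d, quad_expansion rgamma (1 - INR j + INR m) d (B * 6 ^ m).
Proof.
  induction j as [|j [B IH]].
  - destruct rgamma_expansion_1 as (d0 & B & H0). exists B. induction m as [|m [d IH]].
    + exists d0. simpl. replace (1 - 0 + 0) with 1 by ring. now rewrite Rmult_1_r.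
    + eexists. rewrite S_INR.
      replace (1 - INR 0 + (INR m + 1)) with (1 - INR 0 + INR m + 1) by ring.
      replace (B * 6 ^ S m) with (6 * (B * 6 ^ m)) by (simpl; ring).
      apply rgamma_expansion_up; [|exact IH]. simpl. pose proof (pos_INR m). lra.
  - destruct (IH 0%nat) as [d0 H0]. simpl pow in H0. rewrite Rmult_1_r in H0.
    assert (HB : 0 <= B).
    { destruct H0 as [H0 _]. eapply Rle_trans; [apply Rabs_pos|exact H0]. }
    pose proof (Rabs_pos (- INR j)) as Hj.
    exists ((Rabs (- INR j) + 2) * B). intros [|m].
    + eexists. rewrite S_INR. simpl INR at 2. simpl pow. rewrite Rmult_1_r.
      replace (1 - (INR j + 1) + 0) with (- INR j) by ring.
      apply rgamma_expansion_down.
      replace (- INR j + 1) with (1 - INR j + INR 0) by (simpl; ring). exact H0.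
    + destruct (IH m) as [d Hd]. exists d. rewrite !S_INR.
      replace (1 - (INR j + 1) + (INR m + 1)) with (1 - INR j + INR m) by ring.
      apply (quad_expansion_le _ _ _ (B * 6 ^ m)); [|easy].
      assert (0 < 6 ^ m) by (apply pow_lt; lra). simpl pow.
      apply Rle_trans with (B * (6 * 6 ^ m)); [nra|].
      apply Rmult_le_compat_r; [lra|]. nra.
Qed.

Lemma rgamma_expansion (N : Z) :
  exists B, forall m : nat,
    quad_expansion rgamma (IZR N + INR m + 1) (Derive rgamma (IZR N + INR m + 1)) (B * 6 ^ m).
Proof.
  assert (H : exists B, forall m : nat, exists d,
    quad_expansion rgamma (IZR N + INR m + 1) d (B * 6 ^ m)).
  { destruct (Z_le_dec 0 N) as [HN|HN].
    - destruct (rgamma_expansion_nat 0) as [B HB]. exists (B * 6 ^ (Z.to_nat N)). intros m.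
      destruct (HB (Z.to_nat N + m)%nat) as [d Hd]. exists d.
      replace (IZR N + INR m + 1) with (1 - INR 0 + INR (Z.to_nat N + m)).
      + now rewrite Rmult_assoc, <- pow_add.
      + rewrite plus_INR, (INR_IZR_INZ (Z.to_nat N)), Z2Nat.id by lia. simpl. ring.
    - destruct (rgamma_expansion_nat (Z.to_nat (- N))) as [B HB]. exists B. intros m.
      destruct (HB m) as [d Hd]. exists d.
      replace (IZR N + INR m + 1) with (1 - INR (Z.to_nat (- N)) + INR m); [easy|].
      rewrite (INR_IZR_INZ (Z.to_nat (- N))), Z2Nat.id, opp_IZR by lia. ring. }
  destruct H as [B HB]. exists B. intros m. destruct (HB m) as [d Hd].
  assert (E : Derive rgamma (IZR N + INR m + 1) = d).
  { apply is_derive_unique, (quad_expansion_is_derive _ _ _ _ Hd). }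
  now rewrite E.
Qed.

Lemma is_derive_rgamma (k : Z) : is_derive rgamma (IZR k) (Derive rgamma (IZR k)).
Proof.
  destruct (rgamma_expansion (k - 1)) as [B HB].
  specialize (HB 0%nat). apply quad_expansion_is_derive in HB.
  simpl INR in HB. rewrite minus_IZR in HB.
  now replace (IZR k - 1 + 0 + 1) with (IZR k) in HB by ring.
Qed.

Lemma Derive_rgamma_rec (k : Z) :
  Derive rgamma (IZR k) = rgamma (IZR k + 1) + IZR k * Derive rgamma (IZR k + 1).
Proof.
  apply is_derive_unique.
  apply (is_derive_ext (fun z => z * rgamma (z + 1))).
  - intros t. symmetry. apply rgamma_rec.
  - pose proof (is_derive_rgamma (k + 1)) as H. rewrite plus_IZR in H.
    evar_last.
    + apply (is_derive_mult (fun z => z) (fun z => rgamma (z + 1)) _ 1 (1 * Derive rgamma (IZR k + 1))).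
      * apply (is_derive_id (K := R_AbsRing)).
      * apply (is_derive_comp rgamma (fun z => z + 1)); [exact H|].
        auto_derive; auto.
      * intros; apply Rmult_comm.
    + simpl. unfold plus, mult; simpl. ring.
Qed.

Lemma rgamma_nonpos_int (k : nat) : rgamma (- INR k) = 0.
Proof.
  induction k as [|k IH].
  - rewrite rgamma_rec. simpl. ring.
  - rewrite rgamma_rec, S_INR. replace (- (INR k + 1) + 1) with (- INR k) by ring.
    rewrite IH. ring.
Qed.

(** The zeros of 1/Gamma are simple: its derivative is 1 at 0, and the differentiated functional
    equation multiplies it by [-(k + 1)] on passing from [-k] to [-(k + 1)]. The independence of J
    and Y at positive integer order rests on this. *)
Lemma Derive_rgamma_nonpos_int (k : nat) : Derive rgamma (- INR k) <> 0.
Proof.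
  induction k as [|k IH].
  - replace (- INR 0) with (IZR 0) by (simpl; ring). rewrite Derive_rgamma_rec.
    replace (IZR 0 + 1) with 1 by ring. rewrite rgamma_1. lra.
  - rewrite INR_IZR_INZ, <- opp_IZR, Derive_rgamma_rec, opp_IZR, <- INR_IZR_INZ, S_INR.
    replace (- (INR k + 1) + 1) with (- INR k) by ring. rewrite rgamma_nonpos_int.
    pose proof (pos_INR k). nra.
Qed.

Lemma rgamma_succ_fact (k : nat) : rgamma (INR k + 1) = / INR (fact k).
Proof.
  induction k as [|k IH].
  - simpl. rewrite Rplus_0_l, rgamma_1. field.
  - rewrite (rgamma_rec (INR k + 1)) in IH. rewrite fact_simpl, mult_INR, S_INR.
    pose proof (pos_INR k). pose proof (INR_fact_neq_0 k).
    rewrite Rinv_mult, <- IH. field. lra.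
Qed.

(** * Bessel functions as solutions of Bessel's equation *)

(** The derivative is a separate function, which turns Bessel's equation into a first-order system;
    the singular point 0 is excluded. *)
Definition bessel_solution (nu : R) (f f' : R -> R) : Prop :=
  forall t, 0 < t ->
    is_derive f t (f' t) /\ is_derive f' t (- f' t / t - (1 - nu ^ 2 / t ^ 2) * f t).

Lemma is_derive_lin (a b t du dv : R) (u v : R -> R) :
  is_derive u t du -> is_derive v t dv ->
  is_derive (fun t => a * u t + b * v t) t (a * du + b * dv).
Proof.
  intros Hu Hv. apply (is_derive_plus (V := R_NormedModule)).
  - now apply (is_derive_scal u).
  - now apply (is_derive_scal v).
Qed.

Lemma bessel_solution_lin (nu a b : R) (f f' g g' : R -> R) :
  bessel_solution nu f f' -> bessel_solution nu g g' ->
  bessel_solution nu (fun t => a * f t + b * g t) (fun t => a * f' t + b * g' t).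
Proof.
  intros Hf Hg t Ht. destruct (Hf t Ht) as [F1 F2], (Hg t Ht) as [G1 G2].
  split; [now apply is_derive_lin|].
  evar_last; [exact (is_derive_lin a b _ _ _ _ _ F2 G2)|]. field. lra.
Qed.

Lemma locally_pos (t : R) : 0 < t -> locally t (fun s => 0 < s).
Proof. apply (open_gt 0). Qed.

Lemma bessel_solution_ext (nu : R) (f f' g : R -> R) :
  (forall t, 0 < t -> f t = g t) -> bessel_solution nu f f' -> bessel_solution nu g f'.
Proof.
  intros E H t Ht. destruct (H t Ht) as [H1 H2]. split.
  - apply (is_derive_ext_loc f); [|easy].
    generalize (locally_pos t Ht). apply filter_imp. exact E.
  - now rewrite <- E.
Qed.

Lemma is_derive_0_const (f : R -> R) :
  (forall t, 0 < t -> is_derive f t 0) -> forall s t, 0 < s -> 0 < t -> f s = f t.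
Proof.
  intros H s t Hs Ht.
  destruct (MVT_gen f s t (fun _ => 0)) as [c [_ Hc]].
  - intros x Hx. apply H. pose proof (Rmin_glb_lt _ _ _ Hs Ht). lra.
  - intros x Hx. apply derivable_continuous_pt. exists 0. apply is_derive_Reals, H.
    pose proof (Rmin_glb_lt _ _ _ Hs Ht). lra.
  - lra.
Qed.

(** Abel's identity: the first-order coefficient [1/t] of the equation gives the weight [t]. *)
Lemma bessel_wronskian_const (nu : R) (f f' g g' : R -> R) :
  bessel_solution nu f f' -> bessel_solution nu g g' -> forall s t, 0 < s -> 0 < t ->
  s * (f s * g' s - f' s * g s) = t * (f t * g' t - f' t * g t).
Proof.
  intros Hf Hg. apply (is_derive_0_const (fun s => s * (f s * g' s - f' s * g s))).
  intros t Ht. destruct (Hf t Ht) as [F1 F2], (Hg t Ht) as [G1 G2].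
  auto_derive.
  - repeat split; eexists; eassumption.
  - repeat match goal with |- context [Derive (fun x => ?h x) t] =>
      change (Derive (fun x => h x) t) with (Derive h t) end.
    rewrite (is_derive_unique _ _ _ F1), (is_derive_unique _ _ _ F2),
      (is_derive_unique _ _ _ G1), (is_derive_unique _ _ _ G2). field. lra.
Qed.

Lemma continuous_neq_0_near (f : R -> R) (x : R) : continuous f x -> f x <> 0 ->
  exists eps, 0 < eps /\ forall t, Rabs (t - x) < eps -> f t <> 0.
Proof.
  intros Hc Hx.
  destruct (Hc (fun y => y <> 0)) as [eps He].
  - apply (open_neq 0). exact Hx.
  - exists eps. split; [apply cond_pos|]. intros t Ht. apply He. exact Ht.
Qed.

(** * Entire power series and Frobenius solutions *)

Lemma CV_radius_fact (a : nat -> R) (B K : R) :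
  (forall m, Rabs (a m) <= B * K ^ m / INR (fact m)) -> CV_radius a = p_infty.
Proof.
  intros H.
  assert (L : forall x, is_lim_seq (fun n => a n * x ^ n) 0).
  { intros x. apply ex_series_lim_0.
    apply (ex_series_Rabs_le _ (fun n => B * (/ INR (fact n) * (K * Rabs x) ^ n))).
    - intros n. rewrite Rabs_mult, <- RPow_abs, Rpow_mult_distr.
      replace (B * (/ INR (fact n) * (K ^ n * Rabs x ^ n)))
        with (B * K ^ n / INR (fact n) * Rabs x ^ n)
        by (field; apply INR_fact_neq_0).
      apply Rmult_le_compat_r; [apply pow_le, Rabs_pos|auto].
    - apply (ex_series_scal_l (K := R_AbsRing) (V := R_NormedModule) B).
      exists (exp (K * Rabs x)).
      exact (proj1 (is_pseries_R _ _ _) (is_exp_Reals (K * Rabs x))). }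
  destruct (CV_radius a) as [r| |] eqn:E; [exfalso|easy|exfalso].
  - apply (CV_disk_outside a (Rabs r + 1)); [|apply L].
    rewrite E. simpl. rewrite (Rabs_pos_eq (Rabs r + 1)).
    + pose proof (Rle_abs r); lra.
    + pose proof (Rabs_pos r); lra.
  - apply (CV_disk_outside a 1); [|apply L]. now rewrite E.
Qed.

Lemma entire_ex_pseries (a : nat -> R) (y : R) : CV_radius a = p_infty -> ex_pseries a y.
Proof. intros H. apply CV_radius_inside. now rewrite H. Qed.

Lemma entire_is_derive (a : nat -> R) (y : R) : CV_radius a = p_infty ->
  is_derive (PSeries a) y (PSeries (PS_derive a) y).
Proof. intros H. apply is_derive_PSeries. now rewrite H. Qed.

Lemma entire_PS_derive (a : nat -> R) :
  CV_radius a = p_infty -> CV_radius (PS_derive a) = p_infty.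
Proof. intros H. now rewrite CV_radius_derive. Qed.

(** Bessel's equation for [(x/2)^s F(y)] with [y = (x/2)^2] becomes [y F'' + (s + 1) F' + F = 0].
    The extra series [b] is an inhomogeneity, which appears once the equation is differentiated in
    the order. *)
Lemma frobenius_PSeries_ode (s : R) (a b : nat -> R) (y : R) :
  CV_radius a = p_infty -> CV_radius b = p_infty ->
  (forall m : nat, (INR m + 1) * (s + INR m + 1) * a (S m) + a m + b m = 0) ->
  y * PSeries (PS_derive (PS_derive a)) y + (s + 1) * PSeries (PS_derive a) y
    + PSeries a y + PSeries b y = 0.
Proof.
  intros Ha Hb H.
  pose proof (entire_PS_derive _ Ha) as Ha1. pose proof (entire_PS_derive _ Ha1) as Ha2.
  assert (X0 := entire_ex_pseries a y Ha). assert (Xb := entire_ex_pseries b y Hb).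
  assert (X1 := entire_ex_pseries _ y Ha1). assert (X2 := entire_ex_pseries _ y Ha2).
  assert (Y2 := ex_pseries_incr_1 _ _ X2).
  assert (Y1 : ex_pseries (PS_scal (s + 1) (PS_derive a)) y).
  { apply ex_pseries_scal; [apply Rmult_comm|easy]. }
  assert (Z1 := ex_pseries_plus _ _ _ Y2 Y1).
  assert (Z2 := ex_pseries_plus _ _ _ Z1 X0).
  rewrite <- PSeries_incr_1, <- PSeries_scal, <- !PSeries_plus by assumption.
  rewrite (PSeries_ext _ (fun _ => 0)).
  - apply PSeries_const_0.
  - intros m. rewrite <- (H m).
    unfold PS_plus, PS_scal, PS_incr_1, PS_derive, plus, scal, zero; cbn -[INR].
    unfold mult; cbn -[INR]. destruct m as [|m]; rewrite !S_INR.
    + simpl INR. ring.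
    + ring.
Qed.

Definition frob (s : R) (a : nat -> R) (x : R) : R :=
  Rpower (x / 2) s * PSeries a ((x / 2) ^ 2).
Definition frob' (s : R) (a : nat -> R) (x : R) : R :=
  Rpower (x / 2) s / x *
  (s * PSeries a ((x / 2) ^ 2) + x ^ 2 / 2 * PSeries (PS_derive a) ((x / 2) ^ 2)).

Lemma is_derive_frob (s : R) (a : nat -> R) (x : R) :
  CV_radius a = p_infty -> 0 < x -> is_derive (frob s a) x (frob' s a x).
Proof.
  intros Ha Hx. unfold frob, frob', Rpower.
  assert (H := fun y => entire_is_derive a y Ha).
  auto_derive.
  - repeat split; [lra|]. eexists; apply H.
  - change (Derive (fun x0 => PSeries a x0)) with (Derive (PSeries a)).
    replace (x * / 2 * (x * / 2 * 1)) with ((x / 2) ^ 2) by (simpl; unfold Rdiv; ring).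
    rewrite (is_derive_unique _ _ _ (H ((x / 2) ^ 2))).
    unfold Rdiv. field. lra.
Qed.

Lemma is_derive_frob' (s : R) (a b : nat -> R) (x : R) :
  CV_radius a = p_infty -> CV_radius b = p_infty ->
  (forall m : nat, (INR m + 1) * (s + INR m + 1) * a (S m) + a m + b m = 0) -> 0 < x ->
  is_derive (frob' s a) x (- frob' s a x / x - (1 - s ^ 2 / x ^ 2) * frob s a x
    - frob s b x).
Proof.
  intros Ha Hb Hr Hx.
  assert (H := fun y => entire_is_derive a y Ha).
  assert (H1 := fun y => entire_is_derive _ y (entire_PS_derive a Ha)).
  assert (E := frobenius_PSeries_ode s a b ((x / 2) ^ 2) Ha Hb Hr).
  unfold frob, frob', Rpower.
  auto_derive.
  - repeat split; try lra;
      lazymatch goal with |- context [PS_derive] => eexists; apply H1 | _ => eexists; apply H end.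
  - change (Derive (fun x0 => PSeries a x0)) with (Derive (PSeries a)).
    change (Derive (fun x0 => PSeries (PS_derive a) x0)) with (Derive (PSeries (PS_derive a))).
    replace (x * / 2 * (x * / 2 * 1)) with ((x / 2) ^ 2) by (simpl; unfold Rdiv; ring).
    rewrite (is_derive_unique _ _ _ (H ((x / 2) ^ 2))).
    rewrite (is_derive_unique _ _ _ (H1 ((x / 2) ^ 2))).
    change (x * / 2) with (x / 2).
    set (e := exp _).
    set (y := (x / 2) ^ 2) in *.
    replace (PSeries b y) with
      (- (x ^ 2 / 4 * PSeries (PS_derive (PS_derive a)) y + (s + 1) * PSeries (PS_derive a) y
    + PSeries a y)) by (replace (x ^ 2 / 4) with y by (unfold y; field); lra).
    field. lra.
Qed.

Definition jcoef (s : R) (m : nat) : R :=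
  (-1) ^ m / INR (fact m) * rgamma (s + INR m + 1).
(** The derivative of [jcoef s m] in [s]. *)
Definition dcoef (s : R) (m : nat) : R :=
  (-1) ^ m / INR (fact m) * Derive rgamma (s + INR m + 1).

Lemma besselJ_frob (s x : R) : besselJ s x = frob s (jcoef s) x.
Proof. reflexivity. Qed.

Lemma Rabs_sign_fact (m : nat) (x : R) :
  Rabs ((-1) ^ m / INR (fact m) * x) = Rabs x / INR (fact m).
Proof.
  unfold Rdiv. rewrite !Rabs_mult, pow_1_abs, Rabs_inv.
  rewrite (Rabs_pos_eq (INR (fact m))) by apply pos_INR. ring.
Qed.

(** From [1/2] on, each step divides by [z + m >= 1/2] and so at most doubles the value. Smaller
    arguments reduce to this by shifting the progression. *)
Lemma rgamma_shift_bound (s : R) : exists B, forall m : nat, Rabs (rgamma (s + INR m)) <= B * 2 ^ m.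
Proof.
  revert s. apply down_induction.
  - intros z Hz. exists (Rabs (rgamma z)). induction m as [|m IH].
    + simpl. rewrite Rplus_0_r. lra.
    + pose proof (pos_INR m).
      assert (E : rgamma (z + INR m) = (z + INR m) * rgamma (z + INR (S m))).
      { rewrite S_INR, rgamma_rec. f_equal. f_equal. ring. }
      rewrite E, Rabs_mult, (Rabs_pos_eq (z + INR m)) in IH by lra.
      pose proof (Rabs_pos (rgamma (z + INR (S m)))). simpl pow. nra.
  - intros z [B HB].
    assert (HB0 : 0 <= B).
    { specialize (HB 0%nat). simpl pow in HB. rewrite Rmult_1_r in HB.
      eapply Rle_trans; [apply Rabs_pos|exact HB]. }
    exists (B + Rabs (rgamma z)). intros [|m].
    + simpl. rewrite Rplus_0_r. lra.
    + specialize (HB m). rewrite S_INR. replace (z + (INR m + 1)) with (z + 1 + INR m) by ring.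
      assert (0 < 2 ^ m) by (apply pow_lt; lra).
      pose proof (Rabs_pos (rgamma z)). simpl pow. nra.
Qed.

Lemma jcoef_entire (s : R) : CV_radius (jcoef s) = p_infty.
Proof.
  destruct (rgamma_shift_bound (s + 1)) as [B HB].
  apply (CV_radius_fact _ B 2). intros m. unfold jcoef. rewrite Rabs_sign_fact.
  apply Rmult_le_compat_r; [left; apply Rinv_0_lt_compat, INR_fact_lt_0|].
  replace (s + INR m + 1) with (s + 1 + INR m) by ring. apply HB.
Qed.

Lemma dcoef_entire (N : Z) : CV_radius (dcoef (IZR N)) = p_infty.
Proof.
  destruct (rgamma_expansion N) as [B HB].
  apply (CV_radius_fact _ B 6). intros m. unfold dcoef. rewrite Rabs_sign_fact.
  apply Rmult_le_compat_r; [left; apply Rinv_0_lt_compat, INR_fact_lt_0|].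
  apply HB.
Qed.

Lemma jcoef_rec (s : R) (m : nat) :
  (INR m + 1) * (s + INR m + 1) * jcoef s (S m) + jcoef s m = 0.
Proof.
  unfold jcoef. rewrite (rgamma_rec (s + INR m + 1)), fact_simpl, mult_INR, S_INR.
  replace (s + (INR m + 1) + 1) with (s + INR m + 1 + 1) by ring.
  pose proof (pos_INR m). simpl pow. field. split; [apply INR_fact_neq_0|lra].
Qed.

(** The recurrence [jcoef_rec] differentiated in the order: the factor [s + m + 1] contributes
    [(m + 1) * jcoef s (S m)], a coefficient of the derived series. *)
Lemma dcoef_rec (N : Z) (m : nat) :
  (INR m + 1) * (IZR N + INR m + 1) * dcoef (IZR N) (S m) + dcoef (IZR N) m
    + PS_derive (jcoef (IZR N)) m = 0.
Proof.
  unfold dcoef, PS_derive, jcoef.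
  assert (E := Derive_rgamma_rec (N + Z.of_nat m + 1)).
  rewrite !plus_IZR, <- INR_IZR_INZ in E. rewrite E, fact_simpl, mult_INR, S_INR.
  replace (IZR N + (INR m + 1) + 1) with (IZR N + INR m + 1 + 1) by ring.
  pose proof (pos_INR m). simpl pow. field. split; [apply INR_fact_neq_0|lra].
Qed.

Lemma entire_0 : CV_radius (fun _ => 0) = p_infty.
Proof.
  apply (CV_radius_fact _ 0 0). intros m. rewrite Rabs_R0. unfold Rdiv.
  rewrite !Rmult_0_l. lra.
Qed.

Lemma besselJ_solution (s : R) : bessel_solution s (besselJ s) (frob' s (jcoef s)).
Proof.
  intros t Ht. split.
  - apply (is_derive_frob s (jcoef s)); [apply jcoef_entire|easy].
  - evar_last.
    + apply (is_derive_frob' s (jcoef s) (fun _ => 0)); [apply jcoef_entire|apply entire_0| |easy].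
      intros m. rewrite Rplus_0_r. apply jcoef_rec.
    + rewrite besselJ_frob. unfold frob at 2. rewrite PSeries_const_0. ring.
Qed.

(** Termwise differentiation in the order: the coefficients have quadratic remainders
    [B 6^m h^2 / m!], which sum to a multiple of [h^2] dominated by the exponential series at
    [6 |y|]. *)
Lemma is_derive_PSeries_order (N : Z) (y : R) :
  is_derive (fun s => PSeries (jcoef s) y) (IZR N) (PSeries (dcoef (IZR N)) y).
Proof.
  destruct (rgamma_expansion N) as [B HB].
  set (C := Series (fun m => B * (/ INR (fact m) * (6 * Rabs y) ^ m))).
  assert (HC : ex_series (fun m => B * (/ INR (fact m) * (6 * Rabs y) ^ m))).
  { apply (ex_series_scal_l (K := R_AbsRing) (V := R_NormedModule) B).
    exists (exp (6 * Rabs y)).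
    exact (proj1 (is_pseries_R _ _ _) (is_exp_Reals (6 * Rabs y))). }
  assert (HB0 : 0 <= B).
  { destruct (HB 0%nat) as [H _]. simpl pow in H. rewrite Rmult_1_r in H.
    eapply Rle_trans; [apply Rabs_pos|exact H]. }
  assert (HC0 : 0 <= C).
  { eapply Rle_trans; [apply Rabs_pos|]. apply (Rabs_Series_le (fun _ => 0)); [|exact HC].
    intros m. rewrite Rabs_R0. apply Rmult_le_pos; [easy|]. apply Rmult_le_pos.
    - left. apply Rinv_0_lt_compat, INR_fact_lt_0.
    - apply pow_le. pose proof (Rabs_pos y). lra. }
  assert (Xj : forall s, ex_series (fun k => jcoef s k * y ^ k)).
  { intros s. exact (proj1 (ex_pseries_R _ _) (entire_ex_pseries _ y (jcoef_entire s))). }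
  assert (Xd : ex_series (fun k => dcoef (IZR N) k * y ^ k)).
  { exact (proj1 (ex_pseries_R _ _) (entire_ex_pseries _ y (dcoef_entire N))). }
  apply (quad_expansion_is_derive _ _ _
    (Rabs (PSeries (jcoef (IZR N)) y) + Rabs (PSeries (dcoef (IZR N)) y) + C)).
  pose proof (Rabs_pos (PSeries (jcoef (IZR N)) y)).
  pose proof (Rabs_pos (PSeries (dcoef (IZR N)) y)).
  repeat split; try lra.
  intros h Hh.
  apply Rle_trans with (C * h ^ 2); [|pose proof (pow2_ge_0 h); nra].
  unfold PSeries. rewrite <- Series_scal_l.
  rewrite <- Series_minus; [|apply Xj|apply Xj].
  rewrite <- Series_minus.
  - rewrite Rmult_comm. unfold C. rewrite <- Series_scal_l. apply Rabs_Series_le.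
    + intros m. destruct (HB m) as (_ & _ & H3). specialize (H3 h Hh).
      replace (jcoef (IZR N + h) m * y ^ m - jcoef (IZR N) m * y ^ m
          - h * (dcoef (IZR N) m * y ^ m))
        with ((-1) ^ m / INR (fact m) * ((rgamma (IZR N + INR m + 1 + h)
          - rgamma (IZR N + INR m + 1) - h * Derive rgamma (IZR N + INR m + 1)) * y ^ m)).
      * rewrite Rabs_sign_fact, Rabs_mult, <- RPow_abs, Rpow_mult_distr.
        replace (h ^ 2 * (B * (/ INR (fact m) * (6 ^ m * Rabs y ^ m))))
          with (B * 6 ^ m * h ^ 2 * Rabs y ^ m / INR (fact m)) by (unfold Rdiv; ring).
        apply Rmult_le_compat_r; [left; apply Rinv_0_lt_compat, INR_fact_lt_0|].
        apply Rmult_le_compat_r; [apply pow_le, Rabs_pos|easy].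
      * unfold jcoef, dcoef.
        replace (IZR N + h + INR m + 1) with (IZR N + INR m + 1 + h) by ring.
        unfold Rdiv. ring.
    + now apply (ex_series_scal_l (K := R_AbsRing) (V := R_NormedModule) (h ^ 2)).
  - now apply (ex_series_minus (K := R_AbsRing) (V := R_NormedModule)).
  - now apply (ex_series_scal_l (K := R_AbsRing) (V := R_NormedModule) h).
Qed.

(** The derivative of [J_s(x)] in the order [s]; the logarithm comes from the power [(x/2)^s]. *)
Definition dJ (s x : R) : R := ln (x / 2) * frob s (jcoef s) x + frob s (dcoef s) x.
Definition dJ' (s x : R) : R :=
  frob s (jcoef s) x / x + ln (x / 2) * frob' s (jcoef s) x + frob' s (dcoef s) x.

Lemma is_derive_besselJ_order (N : Z) (x : R) :
  is_derive (fun s => besselJ s x) (IZR N) (dJ (IZR N) x).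
Proof.
  unfold besselJ, Rpower.
  pose proof (is_derive_PSeries_order N ((x / 2) ^ 2)) as H. unfold jcoef at 1 in H.
  evar_last.
  - apply (is_derive_mult (fun s => exp (s * ln (x / 2))) _ _
      (ln (x / 2) * exp (IZR N * ln (x / 2))) (PSeries (dcoef (IZR N)) ((x / 2) ^ 2))).
    + auto_derive; [easy|ring].
    + exact H.
    + apply Rmult_comm.
  - unfold dJ, frob, Rpower, plus, mult, jcoef; simpl. ring.
Qed.

(** Bessel's equation differentiated in the order: [nu^2] contributes the source term
    [2 nu J / t^2]. *)
Lemma dJ_derive (N : Z) (t : R) : 0 < t ->
  is_derive (dJ (IZR N)) t (dJ' (IZR N) t) /\
  is_derive (dJ' (IZR N)) t (- dJ' (IZR N) t / t - (1 - IZR N ^ 2 / t ^ 2) * dJ (IZR N) t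
    + 2 * IZR N * frob (IZR N) (jcoef (IZR N)) t / t ^ 2).
Proof.
  intros Ht.
  destruct (besselJ_solution (IZR N) t Ht) as [F1 F2].
  change (is_derive (frob (IZR N) (jcoef (IZR N))) t (frob' (IZR N) (jcoef (IZR N)) t)) in F1.
  rewrite besselJ_frob in F2.
  pose proof (is_derive_frob (IZR N) _ t (dcoef_entire N) Ht) as G1.
  pose proof (is_derive_frob' (IZR N) _ (PS_derive (jcoef (IZR N))) t (dcoef_entire N)
    (entire_PS_derive _ (jcoef_entire _)) (dcoef_rec N) Ht) as G2.
  unfold dJ, dJ'.
  (* The logarithm leaves a source [2 f' / t] and the series of [dcoef] a source [- q]; [Q] says
     that together they equal [2 N f / t^2]. *)
  assert (Q : IZR N * frob (IZR N) (jcoef (IZR N)) t =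
    t * frob' (IZR N) (jcoef (IZR N)) t - t ^ 2 / 2 * frob (IZR N) (PS_derive (jcoef (IZR N))) t).
  { unfold frob, frob'. field. lra. }
  set (f := frob (IZR N) (jcoef (IZR N))) in *.
  set (f' := frob' (IZR N) (jcoef (IZR N))) in *.
  set (g := frob (IZR N) (dcoef (IZR N))) in *.
  set (g' := frob' (IZR N) (dcoef (IZR N))) in *.
  set (q := frob (IZR N) (PS_derive (jcoef (IZR N))) t) in *.
  clearbody f f' g g' q.
  split.
  - auto_derive.
    + repeat split; try lra; eexists; eassumption.
    + change (Derive (fun x => f x) t) with (Derive f t).
      change (Derive (fun x => g x) t) with (Derive g t).
      rewrite (is_derive_unique _ _ _ F1), (is_derive_unique _ _ _ G1).
      unfold Rdiv. field. lra.
  - auto_derive.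
    + repeat split; try lra; eexists; eassumption.
    + change (Derive (fun x => f x) t) with (Derive f t).
      change (Derive (fun x => f' x) t) with (Derive f' t).
      change (Derive (fun x => g' x) t) with (Derive g' t).
      rewrite (is_derive_unique _ _ _ F1), (is_derive_unique _ _ _ F2), (is_derive_unique _ _ _ G2).
      replace (2 * IZR N * f t) with (2 * (t * f' t - t ^ 2 / 2 * q)) by (rewrite <- Q; ring).
      change (t * / 2) with (t / 2).
      generalize (ln (t / 2)); intros l. field. lra.
Qed.

(** * The function Y of integer order *)

Lemma pow_m1_sqr (n : nat) : (-1) ^ n * (-1) ^ n = 1.
Proof. rewrite <- Rpow_mult_distr. replace (-1 * -1) with 1 by ring. apply pow1. Qed.

Lemma cos_nat_PI (n : nat) : cos (INR n * PI) = (-1) ^ n /\ sin (INR n * PI) = 0.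
Proof.
  induction n as [|n [IH1 IH2]].
  - simpl. rewrite Rmult_0_l, cos_0, sin_0. easy.
  - rewrite S_INR, Rmult_plus_distr_r, Rmult_1_l, neg_cos, neg_sin, IH1, IH2. simpl. split; ring.
Qed.

(** At order [-n] the first [n] coefficients vanish with 1/Gamma at its zeros; shifting the index by
    [n] gives the series of order [n] up to sign. *)
Lemma besselJ_opp_nat (n : nat) (x : R) : 0 < x ->
  besselJ (- INR n) x = (-1) ^ n * besselJ (INR n) x.
Proof.
  intros Hx. rewrite !besselJ_frob. unfold frob.
  rewrite (PSeries_decr_n_aux (jcoef (- INR n)) n).
  - rewrite (PSeries_ext (PS_decr_n (jcoef (- INR n)) n) (PS_scal ((-1) ^ n) (jcoef (INR n)))).
    + rewrite PSeries_scal, Rpower_Ropp, Rpower_pow by lra.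
      rewrite <- pow_mult, Nat.mul_comm, pow_mult.
      assert ((x / 2) ^ n <> 0) by (apply pow_nonzero; lra). simpl pow at 2. field. easy.
    + intros k. unfold PS_decr_n, PS_scal, scal, jcoef; simpl. unfold mult; simpl.
      rewrite plus_INR. replace (- INR n + (INR n + INR k) + 1) with (INR k + 1) by ring.
      rewrite <- plus_INR, !rgamma_succ_fact, pow_add. unfold Rdiv. ring.
  - intros k Hk. unfold jcoef.
    replace (- INR n + INR k + 1) with (- INR (n - S k)).
    + rewrite rgamma_nonpos_int. ring.
    + rewrite minus_INR, S_INR by lia. ring.
Qed.

Lemma frob'_opp_nat (n : nat) (x : R) : 0 < x ->
  frob' (- INR n) (jcoef (- INR n)) x = (-1) ^ n * frob' (INR n) (jcoef (INR n)) x.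
Proof.
  intros Hx.
  assert (D1 := is_derive_frob (- INR n) _ x (jcoef_entire (- INR n)) Hx).
  assert (D2 := is_derive_frob (INR n) _ x (jcoef_entire (INR n)) Hx).
  apply (is_derive_scal (frob (INR n) (jcoef (INR n))) x ((-1) ^ n)) in D2.
  rewrite <- (is_derive_unique _ _ _ D1), <- (is_derive_unique _ _ _ D2).
  apply Derive_ext_loc. generalize (locally_pos x Hx). apply filter_imp.
  intros y Hy. exact (besselJ_opp_nat n y Hy).
Qed.

Lemma is_lim_quotient_0 (F : R -> R) (a l : R) :
  is_derive F a l -> F a = 0 -> is_lim (fun t => F t / (t - a)) a l.
Proof.
  intros H H0. apply is_lim_spec. intros eps.
  apply is_derive_Reals in H. destruct (H eps (cond_pos eps)) as [d Hd].
  assert (E : forall y : R, a + (y - a) = y) by (intros; ring).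
  exists d. intros y Hy Hya. simpl.
  specialize (Hd (y - a) (Rminus_eq_contra _ _ Hya) Hy).
  now rewrite E, H0, Rminus_0_r in Hd.
Qed.

Lemma is_lim_lhopital_0 (F G : R -> R) (a l m : R) :
  is_derive F a l -> F a = 0 -> is_derive G a m -> G a = 0 -> m <> 0 ->
  is_lim (fun t => F t / G t) a (l / m).
Proof.
  intros HF F0 HG G0 Hm.
  apply (is_lim_ext_loc (fun t => (F t / (t - a)) / (G t / (t - a)))).
  - exists (mkposreal 1 Rlt_0_1). intros y _ Hy. unfold Rdiv.
    rewrite Rinv_mult, Rinv_inv.
    replace (F y * / (y - a) * (/ G y * (y - a))) with (F y * / G y * (/ (y - a) * (y - a))) by ring.
    rewrite Rinv_l by lra. ring.
  - apply (is_lim_div _ _ a l m).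
    + now apply is_lim_quotient_0.
    + now apply is_lim_quotient_0.
    + intros E. injection E. easy.
    + unfold is_Rbar_div, is_Rbar_mult. simpl. easy.
Qed.

(** L'Hopital's rule in the order: the numerator vanishes at [n] because [J_{-n} = (-1)^n J_n], and
    the denominator has derivative [PI (-1)^n] there. *)
Lemma besselY_nat (n : nat) (x : R) : 0 < x ->
  besselY (INR n) x = / PI * dJ (INR n) x + / PI * (-1) ^ n * dJ (- INR n) x.
Proof.
  intros Hx. destruct (cos_nat_PI n) as [Hc Hs].
  unfold besselY. destruct (Req_EM_T (sin (INR n * PI)) 0) as [_|E]; [|easy].
  pose proof (pow_m1_sqr n) as e2.
  assert (e0 : (-1) ^ n <> 0) by (apply pow_nonzero; lra).
  pose proof PI_neq0 as Hpi.
  assert (L : is_lim (fun mu => besselY_formula mu x) (INR n)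
    ((dJ (INR n) x * (-1) ^ n + dJ (- INR n) x) / (PI * (-1) ^ n))).
  { unfold besselY_formula.
    apply (is_lim_lhopital_0 (fun mu => besselJ mu x * cos (mu * PI) - besselJ (- mu) x)
             (fun mu => sin (mu * PI))).
    - pose proof (is_derive_besselJ_order (Z.of_nat n) x) as D1.
      pose proof (is_derive_besselJ_order (- Z.of_nat n) x) as D2.
      rewrite opp_IZR in D2. rewrite <- INR_IZR_INZ in D1, D2.
      set (f := fun s : R => besselJ s x).
      change (is_derive f (INR n) (dJ (INR n) x)) in D1.
      change (is_derive f (- INR n) (dJ (- INR n) x)) in D2.
      change (is_derive (fun mu => f mu * cos (mu * PI) - f (- mu)) (INR n)
        (dJ (INR n) x * (-1) ^ n + dJ (- INR n) x)).
      clearbody f.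
      auto_derive.
      + repeat split; eexists; eassumption.
      + change (Derive (fun x => f x)) with (Derive f).
        rewrite (is_derive_unique _ _ _ D1), (is_derive_unique _ _ _ D2), Hc, Hs. ring.
    - rewrite Hc, besselJ_opp_nat by easy. ring.
    - auto_derive; [easy|]. rewrite Hc. ring.
    - easy.
    - now apply Rmult_integral_contrapositive_currified. }
  rewrite (is_lim_unique _ _ _ L). cbn [real].
  apply (Rmult_eq_reg_r (PI * (-1) ^ n)); [|now apply Rmult_integral_contrapositive_currified].
  transitivity (dJ (INR n) x * (-1) ^ n + dJ (- INR n) x * ((-1) ^ n * (-1) ^ n)).
  - rewrite e2. field. easy.
  - field. easy.
Qed.

(** The source terms [2 n J_n / t^2] and [- 2 n (-1)^n J_{-n} / t^2] of the two order derivatives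
    cancel, again by [J_{-n} = (-1)^n J_n]. *)
Lemma besselY_nat_solution (n : nat) :
  bessel_solution (INR n) (besselY (INR n))
    (fun x => / PI * dJ' (INR n) x + / PI * (-1) ^ n * dJ' (- INR n) x).
Proof.
  apply (bessel_solution_ext _ (fun x => / PI * dJ (INR n) x + / PI * (-1) ^ n * dJ (- INR n) x)).
  { intros t Ht. now rewrite besselY_nat. }
  intros t Ht.
  destruct (dJ_derive (Z.of_nat n) t Ht) as [A1 A2].
  destruct (dJ_derive (- Z.of_nat n) t Ht) as [B1 B2].
  rewrite opp_IZR in B1, B2. rewrite <- INR_IZR_INZ in A1, A2, B1, B2.
  split; [exact (is_derive_lin _ _ _ _ _ _ _ A1 B1)|].
  evar_last; [exact (is_derive_lin _ _ _ _ _ _ _ A2 B2)|].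
  pose proof (besselJ_opp_nat n t Ht) as E. rewrite !besselJ_frob in E. rewrite E.
  pose proof (pow_m1_sqr n) as e2.
  (* The two sides agree only modulo [(-1)^n * (-1)^n = 1], so their difference is written as a
     multiple of [1 - (-1)^n * (-1)^n]. *)
  match goal with |- ?l = ?r =>
    assert (X : l - r = (1 - (-1) ^ n * (-1) ^ n) *
      (/ PI * (2 * INR n * frob (INR n) (jcoef (INR n)) t / t ^ 2))) end.
  { field. split; [lra|apply PI_neq0]. }
  rewrite e2 in X. lra.
Qed.

(** The Wronskian constant is read off at the singular point: [phi] is an expression for it that
    extends continuously to 0, where only leading coefficients of the Frobenius series survive. *)
Lemma wronskian_neq_0 (nu : R) (f f' g g' phi : R -> R) :
  bessel_solution nu f f' -> bessel_solution nu g g' ->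
  ex_derive phi 0 -> phi 0 <> 0 ->
  (forall t, 0 < t -> t * (f t * g' t - f' t * g t) = phi t) ->
  exists w, w <> 0 /\ forall t, 0 < t -> t * (f t * g' t - f' t * g t) = w.
Proof.
  intros Hf Hg Hc H0 E.
  destruct (continuous_neq_0_near phi 0 (ex_derive_continuous phi 0 Hc) H0) as (eps & He & Hn).
  exists (phi (eps / 2)). split.
  - apply Hn. rewrite Rminus_0_r, Rabs_pos_eq; lra.
  - intros t Ht. rewrite <- E by lra.
    apply (bessel_wronskian_const nu f f' g g' Hf Hg); lra.
Qed.

Lemma ex_derive_PSeries_sqr (a : nat -> R) :
  CV_radius a = p_infty -> ex_derive (fun x => PSeries a ((x / 2) ^ 2)) 0.
Proof.
  intros Ha. assert (H := entire_is_derive a ((0 / 2) ^ 2) Ha).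
  apply (ex_derive_comp (PSeries a) (fun x => (x / 2) ^ 2)).
  - eexists; exact H.
  - auto_derive; auto.
Qed.

Lemma PSeries_sqr_0 (a : nat -> R) : PSeries a ((0 / 2) ^ 2) = a 0%nat.
Proof. replace ((0 / 2) ^ 2) with 0 by field. apply PSeries_0. Qed.

Lemma jcoef_0 (s : R) : jcoef s 0 = rgamma (s + 1).
Proof. unfold jcoef. simpl. rewrite Rplus_0_r. field. Qed.

Lemma dcoef_0 (s : R) : dcoef s 0 = Derive rgamma (s + 1).
Proof. unfold dcoef. simpl. rewrite Rplus_0_r. field. Qed.

(** The logarithms in Y multiply J and hence contribute only [2 J^2 / PI]. At 0 this is the
    surviving term when [n = 0], since the other carries the factor [n]. For [n >= 1] it vanishes
    with [(x/2)^n], and [- 2 n G(0) M(0)] remains up to a nonzero factor, where [M(0)] is the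
    derivative of 1/Gamma at its zero [1 - n]. *)
Lemma besselY_nat_wronskian (n : nat) : exists w, w <> 0 /\ forall t, 0 < t ->
  t * (besselJ (INR n) t * (/ PI * dJ' (INR n) t + / PI * (-1) ^ n * dJ' (- INR n) t)
       - frob' (INR n) (jcoef (INR n)) t * besselY (INR n) t) = w.
Proof.
  set (P := fun a x => PSeries a ((x / 2) ^ 2)).
  set (G := P (jcoef (INR n))). set (G1 := P (PS_derive (jcoef (INR n)))).
  set (H := P (dcoef (INR n))). set (H1 := P (PS_derive (dcoef (INR n)))).
  set (M := P (dcoef (- INR n))). set (M1 := P (PS_derive (dcoef (- INR n)))).
  pose proof (pow_m1_sqr n) as e2.
  assert (e0 : (-1) ^ n <> 0) by (apply pow_nonzero; lra).
  pose proof PI_neq0 as Hpi.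
  assert (Dn := dcoef_entire (Z.of_nat n)). rewrite <- INR_IZR_INZ in Dn.
  assert (Dm := dcoef_entire (- Z.of_nat n)). rewrite opp_IZR, <- INR_IZR_INZ in Dm.
  apply (wronskian_neq_0 (INR n) (besselJ (INR n)) (frob' (INR n) (jcoef (INR n)))
    (besselY (INR n)) (fun x => / PI * dJ' (INR n) x + / PI * (-1) ^ n * dJ' (- INR n) x)
    (fun x => / PI * ((x / 2) ^ n * (x / 2) ^ n *
        (2 * G x * G x + x ^ 2 / 2 * (G x * H1 x - G1 x * H x))
      + (-1) ^ n * (- 2 * INR n * G x * M x + x ^ 2 / 2 * (G x * M1 x - G1 x * M x))))).
  - apply besselJ_solution.
  - apply besselY_nat_solution.
  - assert (ex_derive G 0) by apply ex_derive_PSeries_sqr, jcoef_entire.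
    assert (ex_derive G1 0) by apply ex_derive_PSeries_sqr, entire_PS_derive, jcoef_entire.
    assert (ex_derive H 0) by now apply ex_derive_PSeries_sqr.
    assert (ex_derive H1 0) by now apply ex_derive_PSeries_sqr, entire_PS_derive.
    assert (ex_derive M 0) by now apply ex_derive_PSeries_sqr.
    assert (ex_derive M1 0) by now apply ex_derive_PSeries_sqr, entire_PS_derive.
    clearbody G G1 H H1 M M1.
    auto_derive. repeat split; assumption.
  - assert (G0 : G 0 <> 0).
    { unfold G, P. rewrite PSeries_sqr_0, jcoef_0.
      apply Rgt_not_eq, rgamma_pos. pose proof (pos_INR n). lra. }
    apply Rmult_integral_contrapositive_currified; [now apply Rinv_neq_0_compat|].
    destruct n as [|n].
    + simpl. replace (1 * 1 * (2 * G 0 * G 0 + 0 * (0 * 1) / 2 * (G 0 * H1 0 - G1 0 * H 0)) +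
        1 * (-2 * 0 * G 0 * M 0 + 0 * (0 * 1) / 2 * (G 0 * M1 0 - G1 0 * M 0)))
        with (2 * (G 0 * G 0)) by field. nra.
    + replace ((0 / 2) ^ S n) with 0
        by (unfold Rdiv; now rewrite Rmult_0_l, pow_ne_zero by lia).
      assert (M0 : M 0 <> 0).
      { unfold M, P. rewrite PSeries_sqr_0, dcoef_0.
        replace (- INR (S n) + 1) with (- INR n) by (rewrite S_INR; ring).
        apply Derive_rgamma_nonpos_int. }
      match goal with |- ?l <> 0 =>
        replace l with ((-1) ^ S n * (- 2 * (INR (S n) * (G 0 * M 0)))) by field end.
      pose proof (not_0_INR (S n) ltac:(lia)).
      assert (INR (S n) * (G 0 * M 0) <> 0)
        by (repeat apply Rmult_integral_contrapositive_currified; assumption).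
      apply Rmult_integral_contrapositive_currified; [assumption|lra].
  - intros t Ht. rewrite besselY_nat by easy. rewrite besselJ_frob. unfold dJ, dJ'.
    rewrite frob'_opp_nat by easy.
    pose proof (besselJ_opp_nat n t Ht) as E. rewrite !besselJ_frob in E. rewrite !E.
    unfold frob, frob'. fold (P (jcoef (INR n)) t) (P (PS_derive (jcoef (INR n))) t)
      (P (dcoef (INR n)) t) (P (PS_derive (dcoef (INR n))) t)
      (P (dcoef (- INR n)) t) (P (PS_derive (dcoef (- INR n))) t).
    fold G G1 H H1 M M1.
    rewrite Rpower_Ropp, Rpower_pow by lra.
    assert (Hp : (t / 2) ^ n <> 0) by (apply pow_nonzero; lra).
    set (p := (t / 2) ^ n) in *. set (l := ln (t / 2)). set (e := (-1) ^ n) in *.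
    match goal with |- ?l = ?r =>
      assert (X : l - r = (e * e - 1) * (/ PI * p * p * G t * G t)) end.
    { field. repeat split; try assumption; lra. }
    rewrite e2 in X. lra.
Qed.

(** * The function Y of non-integer order *)

Lemma nonint_rgamma_neq_0 (nu : R) : sin (nu * PI) <> 0 -> rgamma (- nu + 1) <> 0.
Proof.
  intros Hs. apply rgamma_neq_0. intros k Hk. apply Hs.
  replace nu with (INR (S k)) by (rewrite S_INR; lra).
  apply cos_nat_PI.
Qed.

(** The equation contains only [nu^2], so [J_{-nu}] solves it as well. *)
Lemma besselY_nonint_solution (nu : R) : sin (nu * PI) <> 0 ->
  bessel_solution nu (besselY nu)
    (fun x => cos (nu * PI) / sin (nu * PI) * frob' nu (jcoef nu) x
              + - / sin (nu * PI) * frob' (- nu) (jcoef (- nu)) x).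
Proof.
  intros Hs.
  apply (bessel_solution_ext _ (fun x => cos (nu * PI) / sin (nu * PI) * besselJ nu x
              + - / sin (nu * PI) * besselJ (- nu) x)).
  - intros t _. unfold besselY. destruct (Req_EM_T (sin (nu * PI)) 0) as [E|_]; [easy|].
    unfold besselY_formula. field. easy.
  - apply bessel_solution_lin; [apply besselJ_solution|].
    intros t Ht. rewrite <- (Rsqr_pow2 nu), Rsqr_neg, Rsqr_pow2. now apply besselJ_solution.
Qed.

(** The multiple of J in Y drops out, and the powers [(x/2)^nu] and [(x/2)^(-nu)] cancel in the
    rest. The value at 0 is [2 nu G(0) M(0) / sin (nu PI)], with both leading coefficients
    nonzero. *)
Lemma besselY_nonint_wronskian (nu : R) : 0 <= nu -> sin (nu * PI) <> 0 ->
  exists w, w <> 0 /\ forall t, 0 < t ->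
  t * (besselJ nu t * (cos (nu * PI) / sin (nu * PI) * frob' nu (jcoef nu) t
              + - / sin (nu * PI) * frob' (- nu) (jcoef (- nu)) t)
       - frob' nu (jcoef nu) t * besselY nu t) = w.
Proof.
  intros Hnu Hs.
  set (P := fun a x => PSeries a ((x / 2) ^ 2)).
  set (G := P (jcoef nu)). set (G1 := P (PS_derive (jcoef nu))).
  set (M := P (jcoef (- nu))). set (M1 := P (PS_derive (jcoef (- nu)))).
  apply (wronskian_neq_0 nu (besselJ nu) (frob' nu (jcoef nu)) (besselY nu)
    (fun x => cos (nu * PI) / sin (nu * PI) * frob' nu (jcoef nu) x
              + - / sin (nu * PI) * frob' (- nu) (jcoef (- nu)) x)
    (fun x => / sin (nu * PI) *
       (2 * (nu * (G x * M x)) + x ^ 2 / 2 * (G1 x * M x - G x * M1 x)))).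
  - apply besselJ_solution.
  - now apply besselY_nonint_solution.
  - assert (ex_derive G 0) by apply ex_derive_PSeries_sqr, jcoef_entire.
    assert (ex_derive G1 0) by apply ex_derive_PSeries_sqr, entire_PS_derive, jcoef_entire.
    assert (ex_derive M 0) by apply ex_derive_PSeries_sqr, jcoef_entire.
    assert (ex_derive M1 0) by apply ex_derive_PSeries_sqr, entire_PS_derive, jcoef_entire.
    clearbody G G1 M M1.
    auto_derive. repeat split; assumption.
  - assert (G0 : G 0 <> 0).
    { unfold G, P. rewrite PSeries_sqr_0, jcoef_0. apply Rgt_not_eq, rgamma_pos. lra. }
    assert (M0 : M 0 <> 0).
    { unfold M, P. rewrite PSeries_sqr_0, jcoef_0. now apply nonint_rgamma_neq_0. }
    assert (nu <> 0).
    { intros E. apply Hs. rewrite E, Rmult_0_l. apply sin_0. }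
    apply Rmult_integral_contrapositive_currified; [now apply Rinv_neq_0_compat|].
    match goal with |- ?l <> 0 => replace l with (2 * (nu * (G 0 * M 0))) by field end.
    repeat apply Rmult_integral_contrapositive_currified; try assumption. lra.
  - intros t Ht. unfold besselY. destruct (Req_EM_T (sin (nu * PI)) 0) as [E|_]; [easy|].
    unfold besselY_formula. rewrite !besselJ_frob.
    unfold frob, frob'. fold (P (jcoef nu) t) (P (PS_derive (jcoef nu)) t)
      (P (jcoef (- nu)) t) (P (PS_derive (jcoef (- nu))) t).
    fold G G1 M M1. rewrite Rpower_Ropp.
    assert (Hp : Rpower (t / 2) nu <> 0) by (apply Rgt_not_eq, exp_pos).
    field. repeat split; try assumption; lra.
Qed.

(** Up to a positive factor the expression is [(nu - delta) G(t) + t^2/2 G1(t)]. If [nu] differs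
    from [delta] the first term dominates near 0. If [nu = delta] it is absent, and
    [G1(0) = - 1/Gamma(nu + 2)] decides. *)
Lemma besselJ_log_derivative_near_0 (nu delta : R) : Rabs delta <= nu ->
  exists eps, 0 < eps /\ forall t, 0 < t < eps ->
    frob' nu (jcoef nu) t - delta / t * besselJ nu t <> 0.
Proof.
  intros Hd. apply Rabs_le_between in Hd.
  set (P := fun a x => PSeries a ((x / 2) ^ 2)).
  set (G := P (jcoef nu)). set (G1 := P (PS_derive (jcoef nu))).
  assert (DG : ex_derive G 0) by apply ex_derive_PSeries_sqr, jcoef_entire.
  assert (DG1 : ex_derive G1 0) by apply ex_derive_PSeries_sqr, entire_PS_derive, jcoef_entire.
  assert (E : forall t, 0 < t -> frob' nu (jcoef nu) t - delta / t * besselJ nu t =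
    Rpower (t / 2) nu / t * ((nu - delta) * G t + t ^ 2 / 2 * G1 t)).
  { intros t Ht. rewrite besselJ_frob. unfold frob, frob', G, G1, P. field. lra. }
  assert (Hp : forall t, 0 < t -> Rpower (t / 2) nu / t <> 0).
  { intros t Ht. apply Rgt_not_eq, Rdiv_lt_0_compat; [apply exp_pos|easy]. }
  assert (G0 : G 0 = rgamma (nu + 1)).
  { unfold G, P. now rewrite PSeries_sqr_0, jcoef_0. }
  destruct (Req_dec nu delta) as [Hnd|Hnd].
  - assert (G10 : G1 0 <> 0).
    { unfold G1, P. rewrite PSeries_sqr_0. unfold PS_derive, jcoef. simpl.
      pose proof (rgamma_pos (nu + 1 + 1) ltac:(lra)). lra. }
    destruct (continuous_neq_0_near G1 0 (ex_derive_continuous G1 0 DG1) G10) as (eps & He & Hn).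
    exists eps. split; [easy|]. intros t Ht. rewrite E by lra.
    apply Rmult_integral_contrapositive_currified; [apply Hp; lra|].
    replace ((nu - delta) * G t + t ^ 2 / 2 * G1 t) with (t ^ 2 / 2 * G1 t) by (rewrite Hnd; ring).
    apply Rmult_integral_contrapositive_currified; [nra|].
    apply Hn. rewrite Rminus_0_r, Rabs_pos_eq; lra.
  - set (phi := fun t => (nu - delta) * G t + t ^ 2 / 2 * G1 t).
    assert (Dphi : ex_derive phi 0).
    { unfold phi. clearbody G G1. auto_derive. repeat split; assumption. }
    assert (Phi0 : phi 0 <> 0).
    { unfold phi. rewrite G0. pose proof (rgamma_pos (nu + 1) ltac:(lra)).
      replace (0 ^ 2 / 2) with 0 by field. rewrite Rmult_0_l, Rplus_0_r.
      apply Rmult_integral_contrapositive_currified; lra. }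
    destruct (continuous_neq_0_near phi 0 (ex_derive_continuous phi 0 Dphi) Phi0) as (eps & He & Hn).
    exists eps. split; [easy|]. intros t Ht. rewrite E by lra.
    apply Rmult_integral_contrapositive_currified; [apply Hp; lra|].
    apply Hn. rewrite Rminus_0_r, Rabs_pos_eq; lra.
Qed.

(** Everything that the phase argument takes from the definitions of J and Y. *)
Lemma bessel_basis (nu delta : R) : Rabs delta <= nu ->
  exists J' Y',
    bessel_solution nu (besselJ nu) J' /\ bessel_solution nu (besselY nu) Y' /\
    (exists w, w <> 0 /\ forall t, 0 < t -> t * (besselJ nu t * Y' t - J' t * besselY nu t) = w) /\
    (exists eps, 0 < eps /\ forall t, 0 < t < eps -> J' t - delta / t * besselJ nu t <> 0).
Proof.
  intros Hd. exists (frob' nu (jcoef nu)).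
  assert (Hnu : 0 <= nu) by (pose proof (Rabs_pos delta); lra).
  destruct (Req_dec (sin (nu * PI)) 0) as [Hs|Hs].
  - destruct (sin_eq_0_0 _ Hs) as [k Hk].
    apply Rmult_eq_reg_r in Hk; [|apply PI_neq0].
    assert (Hk0 : (0 <= k)%Z) by (apply le_IZR; lra).
    assert (En : nu = INR (Z.to_nat k)).
    { rewrite INR_IZR_INZ, Z2Nat.id by easy. exact Hk. }
    exists (fun x => / PI * dJ' nu x + / PI * (-1) ^ Z.to_nat k * dJ' (- nu) x).
    split; [apply besselJ_solution|]. split; [|split].
    + rewrite En. apply besselY_nat_solution.
    + rewrite En. apply besselY_nat_wronskian.
    + now apply besselJ_log_derivative_near_0.
  - eexists. split; [apply besselJ_solution|]. split; [|split].
    + now apply besselY_nonint_solution.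
    + now apply besselY_nonint_wronskian.
    + now apply besselJ_log_derivative_near_0.
Qed.

(** * Behaviour of solutions at infinity *)

Lemma nonincreasing_of_derive (f f' : R -> R) (a : R) :
  (forall t, a <= t -> is_derive f t (f' t)) -> (forall t, a <= t -> f' t <= 0) ->
  forall s t, a <= s <= t -> f t <= f s.
Proof.
  intros H H0 s t Hst.
  destruct (MVT_gen f s t f') as [c [Hc E]].
  - intros x Hx. apply H. rewrite Rmin_left in Hx; lra.
  - intros x Hx. apply derivable_continuous_pt. exists (f' x). apply is_derive_Reals, H.
    rewrite Rmin_left in Hx; lra.
  - rewrite Rmin_left in Hc by lra. specialize (H0 c ltac:(lra)). nra.
Qed.

Lemma nondecreasing_of_derive (f f' : R -> R) (a : R) :
  (forall t, a <= t -> is_derive f t (f' t)) -> (forall t, a <= t -> 0 <= f' t) ->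
  forall s t, a <= s <= t -> f s <= f t.
Proof.
  intros H H0 s t Hst. apply Ropp_le_cancel.
  apply (nonincreasing_of_derive (fun t => - f t) (fun t => - f' t) a); [| |easy].
  - intros x Hx. now apply (is_derive_opp f), H.
  - intros x Hx. specialize (H0 x Hx). lra.
Qed.

(** [a + C/t] decreases and [a - C/t] increases, so the two enclose a common limit [l], obtained as
    the supremum of the lower function. *)
Lemma limit_of_derive_bound (a a' : R -> R) (C : R) :
  (forall t, 1 <= t -> is_derive a t (a' t)) -> (forall t, 1 <= t -> Rabs (a' t) <= C / t ^ 2) ->
  exists l, forall t, 1 <= t -> Rabs (a t - l) <= C / t.
Proof.
  intros H Hb.
  assert (HC : 0 <= C).
  { specialize (Hb 1 ltac:(lra)). pose proof (Rabs_pos (a' 1)).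
    replace (C / 1 ^ 2) with C in Hb by field. lra. }
  assert (Hi : forall t, 1 <= t -> 0 <= C / t).
  { intros t Ht. apply Rmult_le_pos; [easy|]. left; apply Rinv_0_lt_compat; lra. }
  assert (D1 : forall s t, 1 <= s <= t -> a t + C / t <= a s + C / s).
  { apply (nonincreasing_of_derive (fun t => a t + C / t) (fun t => a' t - C / t ^ 2)).
    - intros t Ht. specialize (H t Ht). auto_derive.
      + repeat split; [eexists; exact H|lra].
      + change (Derive (fun x => a x) t) with (Derive a t).
        rewrite (is_derive_unique _ _ _ H). field. lra.
    - intros t Ht. specialize (Hb t Ht). apply Rabs_le_between in Hb. lra. }
  assert (D2 : forall s t, 1 <= s <= t -> a s - C / s <= a t - C / t).
  { apply (nondecreasing_of_derive (fun t => a t - C / t) (fun t => a' t + C / t ^ 2)).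
    - intros t Ht. specialize (H t Ht). auto_derive.
      + repeat split; [eexists; exact H|lra].
      + change (Derive (fun x => a x) t) with (Derive a t).
        rewrite (is_derive_unique _ _ _ H). field. lra.
    - intros t Ht. specialize (Hb t Ht). apply Rabs_le_between in Hb. lra. }
  destruct (completeness (fun y => exists s, 1 <= s /\ y = a s - C / s)) as [l [Hu Hl]].
  - exists (a 1 + C / 1). intros y [s [Hs ->]].
    specialize (D1 1 s ltac:(lra)). specialize (Hi s Hs). lra.
  - exists (a 1 - C / 1), 1. lra.
  - exists l. intros t Ht. apply Rabs_le_between.
    assert (a t - C / t <= l) by (apply Hu; exists t; lra).
    assert (l <= a t + C / t); [|lra].
    apply Hl. intros y [s [Hs ->]]. pose proof (Hi s Hs). pose proof (Hi t Ht).
    destruct (Rle_dec s t) as [L|L].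
    + specialize (D2 s t ltac:(lra)). lra.
    + specialize (D1 t s ltac:(lra)). lra.
Qed.

(* Leading behaviour at infinity of [w t = sqrt t * f t], which solves
   [w'' + (1 - (nu^2 - 1/4) / t^2) w = 0], and of its derivative. *)
Definition bessel_asymptotics (f f' : R -> R) (A B : R) : Prop :=
  exists C, forall t, 1 <= t ->
    Rabs (sqrt t * f t - (A * cos t + B * sin t)) <= C / t /\
    Rabs (sqrt t * f' t + f t / (2 * sqrt t) - (B * cos t - A * sin t)) <= C / t.

Lemma Rabs_le_of_sqr (x M : R) : 0 <= M -> x ^ 2 <= M ^ 2 -> Rabs x <= M.
Proof. intros HM H. apply Rabs_le. nra. Qed.

Lemma Rabs_sin_le_1 (t : R) : Rabs (sin t) <= 1.
Proof. apply Rabs_le, SIN_bound. Qed.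

Lemma Rabs_cos_le_1 (t : R) : Rabs (cos t) <= 1.
Proof. apply Rabs_le, COS_bound. Qed.

Lemma Rabs_mult_le (x y X Y : R) : Rabs x <= X -> Rabs y <= Y -> Rabs (x * y) <= X * Y.
Proof.
  intros Hx Hy. rewrite Rabs_mult. apply Rmult_le_compat; auto using Rabs_pos.
Qed.

(** Liouville's normal form: the factor [sqrt t] removes the first-order term. *)
Lemma bessel_sqrt_derive (nu : R) (f f' : R -> R) (t : R) : bessel_solution nu f f' -> 0 < t ->
  is_derive (fun t => sqrt t * f t) t (sqrt t * f' t + f t / (2 * sqrt t)) /\
  is_derive (fun t => sqrt t * f' t + f t / (2 * sqrt t)) t
    (((nu ^ 2 - 1 / 4) / t ^ 2 - 1) * (sqrt t * f t)).
Proof.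
  intros H Ht. destruct (H t Ht) as [H1 H2]. pose proof (sqrt_lt_R0 t Ht) as Hq.
  split.
  - auto_derive.
    + repeat split; [easy|eexists; exact H1].
    + change (Derive (fun x => f x) t) with (Derive f t).
      rewrite (is_derive_unique _ _ _ H1). field. lra.
  - auto_derive.
    + repeat split; try lra; eexists; eassumption.
    + change (Derive (fun x => f x) t) with (Derive f t).
      change (Derive (fun x => f' x) t) with (Derive f' t).
      rewrite (is_derive_unique _ _ _ H1), (is_derive_unique _ _ _ H2).
      set (q := sqrt t) in *. assert (Et : t = q * q) by (unfold q; now rewrite sqrt_sqrt by lra).
      generalize (f t) (f' t); intros x y. clearbody q. subst t. field. lra.
Qed.

(** A weighted energy first bounds [w]; variation of constants then compares it with the solutions
    of [w'' + w = 0]. *)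
Lemma bessel_solution_asymptotics (nu : R) (f f' : R -> R) : bessel_solution nu f f' ->
  exists A B, bessel_asymptotics f f' A B.
Proof.
  intros H.
  set (w := fun t => sqrt t * f t). set (w' := fun t => sqrt t * f' t + f t / (2 * sqrt t)).
  set (k := nu ^ 2 - 1 / 4).
  assert (W1 : forall t, 1 <= t -> is_derive w t (w' t)).
  { intros t Ht. apply (bessel_sqrt_derive nu f f' t H). lra. }
  assert (W2 : forall t, 1 <= t -> is_derive w' t ((k / t ^ 2 - 1) * w t)).
  { intros t Ht. apply (bessel_sqrt_derive nu f f' t H). lra. }
  change (exists A B C, forall t, 1 <= t ->
    Rabs (w t - (A * cos t + B * sin t)) <= C / t /\
    Rabs (w' t - (B * cos t - A * sin t)) <= C / t).
  clearbody w w' k.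
  (* The energy [w^2 + w'^2] changes at rate [2 k w w' / t^2], at most [|k| / t^2] times itself in
     size. The weight [exp (|k| / t)] decreases at exactly this relative rate and compensates any
     growth. *)
  assert (HE : forall t, 1 <= t ->
    exp (Rabs k / t) * (w t ^ 2 + w' t ^ 2) <= exp (Rabs k / 1) * (w 1 ^ 2 + w' 1 ^ 2)).
  { intros t Ht.
    apply (nonincreasing_of_derive (fun t => exp (Rabs k / t) * (w t ^ 2 + w' t ^ 2))
      (fun t => exp (Rabs k / t) * ((2 * k * (w t * w' t) - Rabs k * (w t ^ 2 + w' t ^ 2)) / t ^ 2))
      1); [| |lra].
    - intros s Hs. specialize (W1 s Hs). specialize (W2 s Hs). auto_derive.
      + repeat split; try lra; eexists; eassumption.
      + change (Derive (fun x => w x) s) with (Derive w s).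
        change (Derive (fun x => w' x) s) with (Derive w' s).
        rewrite (is_derive_unique _ _ _ W1), (is_derive_unique _ _ _ W2).
        change (Rabs k * / s) with (Rabs k / s).
        generalize (exp (Rabs k / s)); intros e. field. lra.
    - intros s Hs.
      assert (2 * k * (w s * w' s) <= Rabs k * (w s ^ 2 + w' s ^ 2)).
      { destruct (Rcase_abs k) as [Hk|Hk].
        - rewrite Rabs_left by easy. pose proof (pow2_ge_0 (w s + w' s)). nra.
        - rewrite Rabs_right by easy. pose proof (pow2_ge_0 (w s - w' s)). nra. }
      assert (0 < / s ^ 2) by (apply Rinv_0_lt_compat; nra).
      pose proof (exp_pos (Rabs k / s)). unfold Rdiv.
      assert ((2 * k * (w s * w' s) - Rabs k * (w s ^ 2 + w' s ^ 2)) * / s ^ 2 <= 0) by nra.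
      unfold Rdiv in *. nra. }
  set (E1 := exp (Rabs k / 1) * (w 1 ^ 2 + w' 1 ^ 2)) in *.
  assert (HE1 : forall t, 1 <= t -> w t ^ 2 + w' t ^ 2 <= E1).
  { intros t Ht. specialize (HE t Ht).
    assert (1 <= exp (Rabs k / t)).
    { rewrite <- exp_0. assert (0 <= Rabs k / t).
      { apply Rmult_le_pos; [apply Rabs_pos|]. left; apply Rinv_0_lt_compat; lra. }
      destruct (Rle_lt_or_eq_dec _ _ H0) as [L|L].
      - left; now apply exp_increasing.
      - rewrite <- L; lra. }
    pose proof (pow2_ge_0 (w t)). pose proof (pow2_ge_0 (w' t)). nra. }
  assert (E0 : 0 <= E1).
  { specialize (HE1 1 ltac:(lra)). pose proof (pow2_ge_0 (w 1)). pose proof (pow2_ge_0 (w' 1)). lra. }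
  assert (Hw : forall t, 1 <= t -> Rabs (w t) <= E1 + 1).
  { intros t Ht. specialize (HE1 t Ht). pose proof (pow2_ge_0 (w' t)).
    apply Rabs_le_of_sqr; [lra|nra]. }
  assert (Hk : forall t, 1 <= t -> Rabs (k / t ^ 2 * w t) <= Rabs k * (E1 + 1) / t ^ 2).
  { intros t Ht. replace (Rabs k * (E1 + 1) / t ^ 2) with (Rabs k / t ^ 2 * (E1 + 1))
      by (field; lra).
    apply Rabs_mult_le; [|now apply Hw]. rewrite Rabs_div by nra.
    rewrite (Rabs_pos_eq (t ^ 2)) by apply pow2_ge_0. lra. }
  (* In the frame rotating with angle [t] the coordinates of [(w, w')] would be constant for
     [w'' + w = 0]; here their derivatives are of order [1 / t^2], and the limits are the amplitudes
     [A] and [B]. *)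
  destruct (limit_of_derive_bound (fun t => w t * cos t - w' t * sin t)
    (fun t => k / t ^ 2 * w t * - sin t) (Rabs k * (E1 + 1))) as [A HA].
  { intros t Ht. specialize (W1 t Ht). specialize (W2 t Ht). auto_derive.
    - repeat split; [eexists; exact W1|eexists; exact W2].
    - change (Derive (fun x => w x) t) with (Derive w t).
      change (Derive (fun x => w' x) t) with (Derive w' t).
      rewrite (is_derive_unique _ _ _ W1), (is_derive_unique _ _ _ W2). field. lra. }
  { intros t Ht. rewrite <- (Rmult_1_r (Rabs k * (E1 + 1) / t ^ 2)). apply Rabs_mult_le; [auto|].
    rewrite Rabs_Ropp. apply Rabs_sin_le_1. }
  destruct (limit_of_derive_bound (fun t => w t * sin t + w' t * cos t)
    (fun t => k / t ^ 2 * w t * cos t) (Rabs k * (E1 + 1))) as [B HB].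
  { intros t Ht. specialize (W1 t Ht). specialize (W2 t Ht). auto_derive.
    - repeat split; [eexists; exact W1|eexists; exact W2].
    - change (Derive (fun x => w x) t) with (Derive w t).
      change (Derive (fun x => w' x) t) with (Derive w' t).
      rewrite (is_derive_unique _ _ _ W1), (is_derive_unique _ _ _ W2). field. lra. }
  { intros t Ht. rewrite <- (Rmult_1_r (Rabs k * (E1 + 1) / t ^ 2)). apply Rabs_mult_le; [auto|].
    apply Rabs_cos_le_1. }
  exists A, B, (2 * (Rabs k * (E1 + 1))). intros t Ht.
  specialize (HA t Ht). specialize (HB t Ht). cbv beta in HA, HB.
  set (a := w t * cos t - w' t * sin t) in *. set (b := w t * sin t + w' t * cos t) in *.
  assert (S2 : sin t * sin t + cos t * cos t = 1) by exact (sin2_cos2 t).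
  replace (2 * (Rabs k * (E1 + 1)) / t) with
    (Rabs k * (E1 + 1) / t * 1 + Rabs k * (E1 + 1) / t * 1) by (field; lra).
  split.
  - replace (w t - (A * cos t + B * sin t)) with ((a - A) * cos t + (b - B) * sin t).
    + eapply Rle_trans; [apply Rabs_triang|].
      apply Rplus_le_compat; apply Rabs_mult_le; auto using Rabs_cos_le_1, Rabs_sin_le_1.
    + rewrite <- (Rmult_1_r (w t)) at 1. rewrite <- S2. unfold a, b. ring.
  - replace (w' t - (B * cos t - A * sin t)) with ((b - B) * cos t + (a - A) * - sin t).
    + eapply Rle_trans; [apply Rabs_triang|].
      apply Rplus_le_compat; apply Rabs_mult_le; rewrite ?Rabs_Ropp;
        auto using Rabs_cos_le_1, Rabs_sin_le_1.
    + rewrite <- (Rmult_1_r (w' t)) at 1. rewrite <- S2. unfold a, b. ring.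
Qed.

Lemma bessel_asymptotics_lin (f f' g g' : R -> R) (A B A' B' a b : R) :
  bessel_asymptotics f f' A B -> bessel_asymptotics g g' A' B' ->
  bessel_asymptotics (fun t => a * f t + b * g t) (fun t => a * f' t + b * g' t)
    (a * A + b * A') (a * B + b * B').
Proof.
  intros [C HC] [C' HC']. exists (Rabs a * C + Rabs b * C'). intros t Ht.
  destruct (HC t Ht) as [X1 X2]. destruct (HC' t Ht) as [Y1 Y2].
  pose proof (sqrt_lt_R0 t ltac:(lra)) as Hq.
  assert (K : forall x y, Rabs x <= C / t -> Rabs y <= C' / t ->
    Rabs (a * x + b * y) <= (Rabs a * C + Rabs b * C') / t).
  { intros x y Hx Hy.
    replace ((Rabs a * C + Rabs b * C') / t) with (Rabs a * (C / t) + Rabs b * (C' / t))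
      by (field; lra).
    eapply Rle_trans; [apply Rabs_triang|].
    apply Rplus_le_compat; apply Rabs_mult_le; auto; lra. }
  split.
  - match goal with |- Rabs ?z <= _ => replace z with (a * (sqrt t * f t - (A * cos t + B * sin t))
      + b * (sqrt t * g t - (A' * cos t + B' * sin t))) by ring end. auto.
  - match goal with |- Rabs ?z <= _ => replace z with
      (a * (sqrt t * f' t + f t / (2 * sqrt t) - (B * cos t - A * sin t))
      + b * (sqrt t * g' t + g t / (2 * sqrt t) - (B' * cos t - A' * sin t)))
      by (field; lra) end. auto.
Qed.

Lemma eq_0_of_bound_div (x K : R) : (forall t, 1 <= t -> Rabs x <= K / t) -> x = 0.
Proof.
  intros H. destruct (Req_dec x 0) as [E|E]; [easy|exfalso].
  apply Rabs_pos_lt in E. pose proof (Rabs_pos K).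
  set (t := 1 + Rabs K / Rabs x).
  assert (Hq : 0 <= Rabs K / Rabs x).
  { apply Rmult_le_pos; [easy|]. left. now apply Rinv_0_lt_compat. }
  specialize (H t ltac:(unfold t; lra)).
  apply Rle_div_r in H; [|unfold t; lra].
  assert (Rabs x * t = Rabs x + Rabs K) by (unfold t; field; lra).
  pose proof (Rle_abs K). lra.
Qed.

(** Multiplying both functions by [sqrt t] produces the weight [t], and the terms [f / (2 sqrt t)]
    cancel. Hence [w] and the Wronskian [A B' - A' B] of the leading terms differ by [O(1/t)]; being
    constants, they are equal. *)
Lemma asymptotics_wronskian (f f' g g' : R -> R) (A B A' B' w : R) :
  bessel_asymptotics f f' A B -> bessel_asymptotics g g' A' B' ->
  (forall t, 0 < t -> t * (f t * g' t - f' t * g t) = w) -> A * B' - A' * B = w.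
Proof.
  intros [C HC] [C' HC'] Hw.
  apply Rminus_diag_uniq_sym.
  apply (eq_0_of_bound_div _ (4 * (Rabs C * Rabs C') + 2 * (Rabs C * (Rabs A' + Rabs B'))
    + 2 * (Rabs C' * (Rabs A + Rabs B)))).
  intros t Ht. destruct (HC t Ht) as [X1 X2]. destruct (HC' t Ht) as [Y1 Y2].
  specialize (Hw t ltac:(lra)).
  pose proof (sqrt_lt_R0 t ltac:(lra)) as Hq.
  assert (Et : sqrt t * sqrt t = t) by (apply sqrt_sqrt; lra).
  set (p := sqrt t * f t - (A * cos t + B * sin t)) in *.
  set (p' := sqrt t * f' t + f t / (2 * sqrt t) - (B * cos t - A * sin t)) in *.
  set (q := sqrt t * g t - (A' * cos t + B' * sin t)) in *.
  set (q' := sqrt t * g' t + g t / (2 * sqrt t) - (B' * cos t - A' * sin t)) in *.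
  assert (S2 : sin t * sin t + cos t * cos t = 1) by exact (sin2_cos2 t).
  assert (E : w - (A * B' - A' * B) =
    p * q' - p' * q + (p * (B' * cos t - A' * sin t) - p' * (A' * cos t + B' * sin t))
    + (q' * (A * cos t + B * sin t) - q * (B * cos t - A * sin t))).
  { assert (W : (p + (A * cos t + B * sin t)) * (q' + (B' * cos t - A' * sin t))
      - (p' + (B * cos t - A * sin t)) * (q + (A' * cos t + B' * sin t)) = w).
    { rewrite <- Hw. unfold p, p', q, q'.
      transitivity (sqrt t * sqrt t * (f t * g' t - f' t * g t)); [field; lra|now rewrite Et]. }
    rewrite <- W.
    replace (A * B' - A' * B) with ((A * B' - A' * B) * (sin t * sin t + cos t * cos t))
      by (rewrite S2; ring). ring. }
  rewrite E.
  assert (Hit : 0 < / t <= 1).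
  { split; [apply Rinv_0_lt_compat; lra|]. rewrite <- Rinv_1. apply Rinv_le_contravar; lra. }
  assert (BC : forall x, Rabs x <= C / t -> Rabs x <= Rabs C * / t).
  { intros x Hx. pose proof (Rle_abs C). unfold Rdiv in Hx. nra. }
  assert (BC' : forall x, Rabs x <= C' / t -> Rabs x <= Rabs C' * / t).
  { intros x Hx. pose proof (Rle_abs C'). unfold Rdiv in Hx. nra. }
  apply BC in X1, X2. apply BC' in Y1, Y2.
  assert (T : forall a b, Rabs (a * cos t + b * sin t) <= Rabs a + Rabs b).
  { intros a b. eapply Rle_trans; [apply Rabs_triang|].
    rewrite <- (Rmult_1_r (Rabs a)), <- (Rmult_1_r (Rabs b)).
    apply Rplus_le_compat; apply Rabs_mult_le; auto using Rabs_cos_le_1, Rabs_sin_le_1; lra. }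
  assert (T' : forall a b, Rabs (b * cos t - a * sin t) <= Rabs a + Rabs b).
  { intros a b. specialize (T b (- a)). rewrite Rabs_Ropp in T.
    replace (b * cos t - a * sin t) with (b * cos t + - a * sin t) by ring. lra. }
  pose proof (Rabs_mult_le _ _ _ _ X1 Y2) as Z1.
  pose proof (Rabs_mult_le _ _ _ _ X2 Y1) as Z2.
  pose proof (Rabs_mult_le _ _ _ _ X1 (T' A' B')) as Z3.
  pose proof (Rabs_mult_le _ _ _ _ X2 (T A' B')) as Z4.
  pose proof (Rabs_mult_le _ _ _ _ Y2 (T A B)) as Z5.
  pose proof (Rabs_mult_le _ _ _ _ Y1 (T' A B)) as Z6.
  pose proof (Rabs_pos C). pose proof (Rabs_pos C').
  assert (Z0 : Rabs C * / t * (Rabs C' * / t) <= Rabs C * Rabs C' * / t).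
  { replace (Rabs C * / t * (Rabs C' * / t)) with (Rabs C * Rabs C' * / t * / t) by ring.
    assert (0 <= Rabs C * Rabs C' * / t) by (repeat apply Rmult_le_pos; lra). nra. }
  assert (Tr : forall a b c d e h, Rabs (a - b + (c - d) + (e - h)) <=
    Rabs a + Rabs b + Rabs c + Rabs d + Rabs e + Rabs h).
  { intros. repeat (unfold Rabs; destruct Rcase_abs); lra. }
  eapply Rle_trans; [apply Tr|].
  assert (0 <= Rabs C * Rabs C' * / t) by (repeat apply Rmult_le_pos; lra).
  unfold Rdiv. lra.
Qed.

(** * The phase *)

Lemma is_derive_continuity_pt (f : R -> R) (x l : R) : is_derive f x l -> continuity_pt f x.
Proof. intros H. apply derivable_continuous_pt. exists l. now apply is_derive_Reals. Qed.

Lemma IVT_pos (f : R -> R) (a b L : R) :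
  (forall t, 0 < t -> continuity_pt f t) -> 0 < a -> 0 < b -> f a <= L <= f b ->
  exists z, Rmin a b <= z <= Rmax a b /\ f z = L.
Proof.
  intros Hc Ha Hb [[H1|H1] [H2|H2]].
  - destruct (Rtotal_order a b) as [Hab|[Hab|Hab]].
    + rewrite Rmin_left, Rmax_right by lra.
      destruct (IVT_interv (fun t => f t - L) a b) as [z [Hz Ez]]; try lra.
      * intros t Ht. apply continuity_pt_minus; [apply Hc; lra|].
        apply continuity_pt_const. now intros ? ?.
      * exists z. split; lra.
    + subst. lra.
    + rewrite Rmin_right, Rmax_left by lra.
      destruct (IVT_interv (fun t => L - f t) b a) as [z [Hz Ez]]; try lra.
      * intros t Ht. apply continuity_pt_minus; [|apply Hc; lra].
        apply continuity_pt_const. now intros ? ?.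
      * exists z. split; lra.
  - exists b. split; [split; [apply Rmin_r|apply Rmax_r]|easy].
  - exists a. split; [split; [apply Rmin_l|apply Rmax_l]|easy].
  - exists a. split; [split; [apply Rmin_l|apply Rmax_l]|easy].
Qed.

Lemma continuous_primitive_pos (g : R -> R) (c : R) :
  (forall t, 0 < t -> continuous g t) ->
  exists G, G 1 = c /\ forall t, 0 < t -> is_derive G t (g t).
Proof.
  intros Hg. exists (fun t => c + RInt g 1 t). split.
  - rewrite RInt_point. apply Rplus_0_r.
  - intros t Ht. evar_last.
    + apply (is_derive_plus (V := R_NormedModule) (fun _ => c) (RInt g 1)).
      * apply (is_derive_const (V := R_NormedModule)).
      * apply (is_derive_RInt g (RInt g 1) 1 t); [|now apply Hg].
        generalize (locally_pos t Ht). apply filter_imp. intros s Hs.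
        apply (RInt_correct (V := R_CompleteNormedModule)), (ex_RInt_continuous (V := R_CompleteNormedModule)).
        intros z Hz. apply Hg. pose proof (Rmin_glb_lt _ _ _ Rlt_0_1 Hs). lra.
    + apply Rplus_0_l.
Qed.

(** [theta] is the primitive of the angular speed [g] with the right value at 1. The squared sine of
    the angle between the curve and the direction [theta] then has zero derivative and vanishes at
    1. The argument is fixed only modulo PI, which suffices to detect parallel vectors. *)
Lemma polar_phase (v1 v2 dv1 dv2 g : R -> R) :
  (forall t, 0 < t -> is_derive v1 t (dv1 t)) -> (forall t, 0 < t -> is_derive v2 t (dv2 t)) ->
  (forall t, 0 < t -> 0 < v1 t ^ 2 + v2 t ^ 2) -> (forall t, 0 < t -> continuous g t) ->
  (forall t, 0 < t -> v1 t * dv2 t - v2 t * dv1 t = g t * (v1 t ^ 2 + v2 t ^ 2)) ->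
  exists theta, forall t, 0 < t ->
    is_derive theta t (g t) /\ v2 t * cos (theta t) = v1 t * sin (theta t).
Proof.
  intros D1 D2 HN Hg E.
  assert (H0 : exists c, v2 1 * cos c = v1 1 * sin c).
  { destruct (Req_dec (v1 1) 0) as [Z|Z].
    - exists (PI / 2). rewrite Z, cos_PI2. ring.
    - exists (atan (v2 1 / v1 1)). pose proof (tan_atan (v2 1 / v1 1)) as T.
      unfold tan in T.
      assert (cos (atan (v2 1 / v1 1)) <> 0).
      { apply Rgt_not_eq. destruct (atan_bound (v2 1 / v1 1)). apply cos_gt_0; lra. }
      replace (sin (atan (v2 1 / v1 1))) with (v2 1 / v1 1 * cos (atan (v2 1 / v1 1))).
      + field. easy.
      + rewrite <- T at 1. field. easy. }
  destruct H0 as [c Hc].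
  destruct (continuous_primitive_pos g c Hg) as (th & Hth1 & Hth).
  exists th. intros t Ht. split; [now apply Hth|].
  assert (Q : (v2 t * cos (th t) - v1 t * sin (th t)) ^ 2 / (v1 t ^ 2 + v2 t ^ 2) =
    (v2 1 * cos (th 1) - v1 1 * sin (th 1)) ^ 2 / (v1 1 ^ 2 + v2 1 ^ 2)).
  { apply (is_derive_0_const (fun t => (v2 t * cos (th t) - v1 t * sin (th t)) ^ 2
      / (v1 t ^ 2 + v2 t ^ 2))); [|easy|lra].
    clear t Ht. intros t Ht.
    specialize (D1 t Ht). specialize (D2 t Ht). specialize (Hth t Ht).
    specialize (HN t Ht). specialize (E t Ht).
    auto_derive.
    - repeat split; try (eexists; eassumption). simpl in HN. lra.
    - change (Derive (fun x => v1 x) t) with (Derive v1 t).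
      change (Derive (fun x => v2 x) t) with (Derive v2 t).
      change (Derive (fun x => th x) t) with (Derive th t).
      rewrite (is_derive_unique _ _ _ D1), (is_derive_unique _ _ _ D2),
        (is_derive_unique _ _ _ Hth).
      assert (Eg : g t = (v1 t * dv2 t - v2 t * dv1 t) / (v1 t ^ 2 + v2 t ^ 2)).
      { rewrite E. field. lra. }
      rewrite Eg. simpl in HN. simpl pow. field. lra. }
  rewrite Hth1, Hc in Q. replace ((v1 1 * sin c - v1 1 * sin c) ^ 2) with 0 in Q by ring.
  specialize (HN t Ht).
  apply (f_equal (fun y => y * (v1 t ^ 2 + v2 t ^ 2))) in Q.
  unfold Rdiv in Q. rewrite Rmult_assoc, Rinv_l, Rmult_1_r, !Rmult_0_l in Q by lra.
  nra.
Qed.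

(* The Robin-type derivative: [(x^-delta f)' = x^-delta * robin delta f f']. *)
Definition robin (delta : R) (f f' : R -> R) (t : R) : R := f' t - delta / t * f t.

Definition normalized_pair (nu : R) (u1 u1' u2 u2' : R -> R) : Prop :=
  bessel_solution nu u1 u1' /\ bessel_solution nu u2 u2' /\
  forall t, 0 < t -> t * (u1 t * u2' t - u1' t * u2 t) = 1.

(** The angular speed [(v1 v2' - v2 v1') / (v1^2 + v2^2)] of the curve of Robin derivatives,
    simplified by Bessel's equation and the Wronskian normalization. *)
Definition phase_speed (nu delta : R) (u1 u1' u2 u2' : R -> R) (t : R) : R :=
  (1 - (nu ^ 2 - delta ^ 2) / t ^ 2) /
  (t * (robin delta u1 u1' t ^ 2 + robin delta u2 u2' t ^ 2)).

Definition is_phase (nu delta : R) (u1 u1' u2 u2' theta : R -> R) : Prop :=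
  forall t, 0 < t ->
    is_derive theta t (phase_speed nu delta u1 u1' u2 u2' t) /\
    robin delta u2 u2' t * cos (theta t) = robin delta u1 u1' t * sin (theta t).

Lemma is_derive_robin (nu delta t : R) (f f' : R -> R) : bessel_solution nu f f' -> 0 < t ->
  is_derive (robin delta f f') t
    (- f' t / t - (1 - nu ^ 2 / t ^ 2) * f t - delta / t * f' t + delta / t ^ 2 * f t).
Proof.
  intros H Ht. destruct (H t Ht) as [H1 H2]. unfold robin. auto_derive.
  - repeat split; try lra; eexists; eassumption.
  - change (Derive (fun x => f x) t) with (Derive f t).
    change (Derive (fun x => f' x) t) with (Derive f' t).
    rewrite (is_derive_unique _ _ _ H1), (is_derive_unique _ _ _ H2). field. lra.
Qed.

Lemma robin_wronskian (nu delta t : R) (u1 u1' u2 u2' : R -> R) :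
  normalized_pair nu u1 u1' u2 u2' -> 0 < t ->
  t * (u1 t * robin delta u2 u2' t - u2 t * robin delta u1 u1' t) = 1.
Proof.
  intros (_ & _ & H) Ht. rewrite <- (H t Ht). unfold robin. field. lra.
Qed.

Lemma robin_pos (nu delta t : R) (u1 u1' u2 u2' : R -> R) :
  normalized_pair nu u1 u1' u2 u2' -> 0 < t ->
  0 < robin delta u1 u1' t ^ 2 + robin delta u2 u2' t ^ 2.
Proof.
  intros H Ht. pose proof (robin_wronskian nu delta t _ _ _ _ H Ht) as W.
  destruct (Req_dec (robin delta u1 u1' t) 0) as [E1|E1].
  - destruct (Req_dec (robin delta u2 u2' t) 0) as [E2|E2].
    + rewrite E1, E2 in W. lra.
    + pose proof (pow2_gt_0 _ E2). pose proof (pow2_ge_0 (robin delta u1 u1' t)). lra.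
  - pose proof (pow2_gt_0 _ E1). pose proof (pow2_ge_0 (robin delta u2 u2' t)). lra.
Qed.

Lemma phase_exists (nu delta : R) (u1 u1' u2 u2' : R -> R) :
  normalized_pair nu u1 u1' u2 u2' -> exists theta, is_phase nu delta u1 u1' u2 u2' theta.
Proof.
  intros H. pose proof H as (H1 & H2 & HW).
  apply (polar_phase (robin delta u1 u1') (robin delta u2 u2')
    (fun t => - u1' t / t - (1 - nu ^ 2 / t ^ 2) * u1 t - delta / t * u1' t + delta / t ^ 2 * u1 t)
    (fun t => - u2' t / t - (1 - nu ^ 2 / t ^ 2) * u2 t - delta / t * u2' t + delta / t ^ 2 * u2 t)).
  - intros t Ht. now apply is_derive_robin.
  - intros t Ht. now apply is_derive_robin.
  - intros t Ht. now apply (robin_pos nu).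
  - intros t Ht. apply (ex_derive_continuous (phase_speed nu delta u1 u1' u2 u2')).
    pose proof (robin_pos nu delta t _ _ _ _ H Ht) as Hp.
    pose proof (is_derive_robin nu delta t _ _ H1 Ht) as D1.
    pose proof (is_derive_robin nu delta t _ _ H2 Ht) as D2.
    unfold phase_speed.
    set (v1 := robin delta u1 u1') in *. set (v2 := robin delta u2 u2') in *.
    clearbody v1 v2.
    auto_derive. repeat split; try (eexists; eassumption).
    + simpl. nra.
    + simpl in Hp. apply Rgt_not_eq, Rmult_lt_0_compat; easy.
  - intros t Ht. pose proof (robin_pos nu delta t _ _ _ _ H Ht) as Hp.
    unfold phase_speed.
    transitivity ((1 - (nu ^ 2 - delta ^ 2) / t ^ 2) / t * (t * (u1 t * u2' t - u1' t * u2 t))).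
    + unfold robin. field. lra.
    + rewrite HW by easy. field. lra.
Qed.

(** The radius [P] is signed: it is the component [v1 cos theta + v2 sin theta] along the direction
    [theta], which is known only modulo PI. *)
Lemma phase_polar (nu delta : R) (u1 u1' u2 u2' theta : R -> R) (t : R) :
  is_phase nu delta u1 u1' u2 u2' theta -> 0 < t ->
  exists P, P ^ 2 = robin delta u1 u1' t ^ 2 + robin delta u2 u2' t ^ 2 /\
    robin delta u1 u1' t = P * cos (theta t) /\ robin delta u2 u2' t = P * sin (theta t).
Proof.
  intros H Ht. destruct (H t Ht) as [_ E].
  set (v1 := robin delta u1 u1' t) in *. set (v2 := robin delta u2 u2' t) in *.
  assert (S2 : sin (theta t) * sin (theta t) + cos (theta t) * cos (theta t) = 1)
    by exact (sin2_cos2 (theta t)).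
  set (s := sin (theta t)) in *. set (c := cos (theta t)) in *.
  exists (v1 * c + v2 * s).
  assert (E1 : v1 = (v1 * c + v2 * s) * c).
  { transitivity (v1 * (c * c) + s * (v2 * c)); [|ring]. rewrite E.
    transitivity (v1 * (s * s + c * c)); [rewrite S2; ring|ring]. }
  assert (E2 : v2 = (v1 * c + v2 * s) * s).
  { transitivity (v2 * (s * s) + c * (v1 * s)); [|ring]. rewrite <- E.
    transitivity (v2 * (s * s + c * c)); [rewrite S2; ring|ring]. }
  split; [|now split].
  transitivity (((v1 * c + v2 * s) * c) ^ 2 + ((v1 * c + v2 * s) * s) ^ 2).
  - transitivity ((v1 * c + v2 * s) ^ 2 * (s * s + c * c)); [rewrite S2; ring|ring].
  - now rewrite <- E1, <- E2.
Qed.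

Definition phase_gap (rin rout : R) (theta : R -> R) (x : R) : R :=
  theta (rout * x) - theta (rin * x).

(** In polar form the determinant is [P Q sin (theta b - theta a)], with both radii nonzero. *)
Lemma robin_det_phase (nu delta a b : R) (u1 u1' u2 u2' theta : R -> R) :
  normalized_pair nu u1 u1' u2 u2' -> is_phase nu delta u1 u1' u2 u2' theta -> 0 < a -> 0 < b ->
  (robin delta u1 u1' a * robin delta u2 u2' b - robin delta u1 u1' b * robin delta u2 u2' a = 0
   <-> sin (theta b - theta a) = 0).
Proof.
  intros Hn H Ha Hb.
  destruct (phase_polar _ _ _ _ _ _ _ a H Ha) as (P & EP & Pc & Ps).
  destruct (phase_polar _ _ _ _ _ _ _ b H Hb) as (Q & EQ & Qc & Qs).
  pose proof (robin_pos nu delta a _ _ _ _ Hn Ha) as HP. rewrite <- EP in HP.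
  pose proof (robin_pos nu delta b _ _ _ _ Hn Hb) as HQ. rewrite <- EQ in HQ.
  assert (P <> 0) by (intros Z; rewrite Z in HP; lra).
  assert (Q <> 0) by (intros Z; rewrite Z in HQ; lra).
  rewrite Pc, Ps, Qc, Qs, sin_minus.
  split; intros E.
  - apply (Rmult_eq_reg_l (P * Q)); [|now apply Rmult_integral_contrapositive_currified].
    rewrite Rmult_0_r, <- E. ring.
  - transitivity (P * Q * (sin (theta b) * cos (theta a) - cos (theta b) * sin (theta a))); [ring|].
    rewrite E. ring.
Qed.

(* [t^2 u'^2 + (t^2 - nu^2) u^2] has derivative [2 t u^2]. *)
Lemma bessel_energy_lt (nu a b : R) (u u' : R -> R) :
  bessel_solution nu u u' -> 0 < a < b -> (forall t, 0 < t -> u t <> 0 \/ u' t <> 0) ->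
  a ^ 2 * u' a ^ 2 + (a ^ 2 - nu ^ 2) * u a ^ 2 < b ^ 2 * u' b ^ 2 + (b ^ 2 - nu ^ 2) * u b ^ 2.
Proof.
  intros H Hab Hn.
  set (E := fun t => t ^ 2 * u' t ^ 2 + (t ^ 2 - nu ^ 2) * u t ^ 2).
  assert (D : forall t, a <= t -> is_derive E t (2 * t * u t ^ 2)).
  { intros t Ht. destruct (H t ltac:(lra)) as [H1 H2]. unfold E. auto_derive.
    - repeat split; eexists; eassumption.
    - change (Derive (fun x => u x) t) with (Derive u t).
      change (Derive (fun x => u' x) t) with (Derive u' t).
      rewrite (is_derive_unique _ _ _ H1), (is_derive_unique _ _ _ H2). field. lra. }
  assert (M : forall s t, a <= s <= t -> E s <= E t).
  { apply (nondecreasing_of_derive E (fun t => 2 * t * u t ^ 2)); [easy|].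
    intros t Ht. pose proof (pow2_ge_0 (u t)). nra. }
  assert (Hle : E a <= E b) by (apply M; lra).
  (* Equality would make the energy constant on [[a, b]]; its derivative [2 t u^2] would vanish, so
     [u] and [u'] would both be 0 at the midpoint. *)
  destruct Hle as [L|L]; [exact L|exfalso].
  assert (C : forall t, a <= t <= b -> E t = E a).
  { intros t Ht. pose proof (M a t ltac:(lra)). pose proof (M t b ltac:(lra)). lra. }
  assert (Z : forall t, a < t < b -> u t = 0).
  { intros t Ht.
    assert (Dt : is_derive E t 0).
    { apply (is_derive_ext_loc (fun _ => E a)).
      - generalize (filter_and _ _ (open_gt a t (proj1 Ht)) (open_lt b t (proj2 Ht))).
        apply filter_imp. intros s [Hs1 Hs2]. symmetry. apply C. lra.
      - apply (is_derive_const (V := R_NormedModule)). }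
    pose proof (is_derive_unique _ _ _ Dt) as E1.
    rewrite (is_derive_unique _ _ _ (D t ltac:(lra))) in E1.
    destruct (Rmult_integral _ _ E1) as [X|X]; [lra|].
    simpl in X. rewrite Rmult_1_r in X. now destruct (Rmult_integral _ _ X). }
  set (m := (a + b) / 2). assert (Hm : a < m < b) by (unfold m; lra).
  assert (Dm : is_derive u m 0).
  { apply (is_derive_ext_loc (fun _ => 0)).
    - generalize (filter_and _ _ (open_gt a m (proj1 Hm)) (open_lt b m (proj2 Hm))).
      apply filter_imp. intros s [Hs1 Hs2]. symmetry. apply Z. lra.
    - apply (is_derive_const (V := R_NormedModule)). }
  destruct (H m ltac:(lra)) as [Dm' _].
  assert (u' m = 0).
  { rewrite <- (is_derive_unique _ _ _ Dm'). now apply is_derive_unique. }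
  destruct (Hn m ltac:(lra)) as [X|X]; [now apply X, Z|easy].
Qed.

(* If the gap is a multiple of PI, some solution satisfies the Robin condition at both
   [rin * x] and [rout * x]; its energy at such an endpoint [t] is [t * phase_speed t]. *)
Lemma phase_gap_increasing_at_zero (nu delta rin rout x : R) (u1 u1' u2 u2' theta : R -> R) :
  normalized_pair nu u1 u1' u2 u2' -> is_phase nu delta u1 u1' u2 u2' theta ->
  0 < rin < rout -> 0 < x -> sin (phase_gap rin rout theta x) = 0 ->
  0 < rout * phase_speed nu delta u1 u1' u2 u2' (rout * x)
      - rin * phase_speed nu delta u1 u1' u2 u2' (rin * x).
Proof.
  intros Hn H Hr Hx Hs. unfold phase_gap in Hs. pose proof Hn as (H1 & H2 & HW).
  set (a := rin * x) in *. set (b := rout * x) in *.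
  assert (Ha : 0 < a) by (unfold a; nra). assert (Hab : a < b) by (unfold a, b; nra).
  set (s := sin (theta a)). set (c := cos (theta a)).
  (* The coefficient vector is orthogonal to the direction of the curve at [a], so the Robin
     derivative of [u] at [t] is [P sin (theta t - theta a)], which vanishes at [a] and at [b]. *)
  set (u := fun t => - s * u1 t + c * u2 t). set (u' := fun t => - s * u1' t + c * u2' t).
  assert (Hu : bessel_solution nu u u') by now apply bessel_solution_lin.
  assert (S2 : s * s + c * c = 1) by exact (sin2_cos2 (theta a)).
  assert (Hnz : forall t, 0 < t -> u t <> 0 \/ u' t <> 0).
  { intros t Ht. destruct (Req_dec (u t) 0) as [Z|Z]; [right|now left].
    intros Z'. specialize (HW t Ht).
    assert (c * (u1 t * u2' t - u1' t * u2 t) = u1 t * u' t - u1' t * u t)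
      by (unfold u, u'; ring).
    assert (s * (u1 t * u2' t - u1' t * u2 t) = u2 t * u' t - u2' t * u t)
      by (unfold u, u'; ring).
    rewrite Z, Z' in *.
    assert (u1 t * u2' t - u1' t * u2 t <> 0) by (intros Y; rewrite Y in HW; lra).
    assert (c = 0) by (apply (Rmult_eq_reg_r (u1 t * u2' t - u1' t * u2 t)); lra).
    assert (s = 0) by (apply (Rmult_eq_reg_r (u1 t * u2' t - u1' t * u2 t)); lra).
    nra. }
  assert (K : forall t, 0 < t -> sin (theta t - theta a) = 0 ->
    t ^ 2 * u' t ^ 2 + (t ^ 2 - nu ^ 2) * u t ^ 2 = t * phase_speed nu delta u1 u1' u2 u2' t).
  { intros t Ht Hst.
    destruct (phase_polar _ _ _ _ _ _ _ t H Ht) as (P & EP & Pc & Ps).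
    pose proof (robin_pos nu delta t _ _ _ _ Hn Ht) as HP.
    pose proof (robin_wronskian nu delta t _ _ _ _ Hn Ht) as Wt.
    unfold phase_speed. rewrite <- EP in HP |- *.
    assert (P0 : P <> 0) by (intros Z; rewrite Z in HP; lra).
    assert (R0 : u' t = delta / t * u t).
    { apply Rminus_diag_uniq.
      transitivity (- s * robin delta u1 u1' t + c * robin delta u2 u2' t).
      - unfold u, u', robin. ring.
      - rewrite Pc, Ps. rewrite sin_minus in Hst. fold s c in Hst.
        transitivity (P * (sin (theta t) * c - cos (theta t) * s)); [ring|].
        rewrite Hst. ring. }
    assert (C2 : cos (theta t - theta a) ^ 2 = 1).
    { pose proof (sin2_cos2 (theta t - theta a)) as X. unfold Rsqr in X. rewrite Hst in X. nra. }
    (* At such a [t] the directions [theta t] and [theta a] are parallel, so the Wronskian identity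
       [t (u1 v2 - u2 v1) = 1] determines [u t] up to sign. *)
    assert (U2 : (t * P * u t) ^ 2 = 1).
    { rewrite Pc, Ps in Wt.
      set (s' := sin (theta t)) in *. set (c' := cos (theta t)) in *.
      assert (X1 : s' * c = c' * s).
      { rewrite sin_minus in Hst. fold s c s' c' in Hst. lra. }
      assert (X2 : cos (theta t - theta a) = c' * c + s' * s).
      { rewrite cos_minus. reflexivity. }
      assert (X3 : t * P * u t = - cos (theta t - theta a)).
      { assert (S2' : s' * s' + c' * c' = 1) by exact (sin2_cos2 (theta t)).
        rewrite X2.
        transitivity (- ((c' * c + s' * s) * (t * (u1 t * (P * s') - u2 t * (P * c')))));
          [|rewrite Wt; ring].
        transitivity (t * P * (- u1 t * ((c' * c' + s' * s') * s)
                               + u2 t * ((c' * c' + s' * s') * c)));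
          [unfold u; rewrite (Rplus_comm (c' * c')), S2'; ring|].
        transitivity (t * P * (- u1 t * (s' * s' * s + c' * (c' * s))
                               + u2 t * (c' * c' * c + s' * (s' * c)))); [ring|].
        transitivity (t * P * (- u1 t * (s' * s' * s + c' * (s' * c))
                               + u2 t * (c' * c' * c + s' * (c' * s)))); [now rewrite X1|ring]. }
      rewrite X3. rewrite <- C2. ring. }
    assert (V2 : u t ^ 2 = / (t ^ 2 * P ^ 2)).
    { apply (Rmult_eq_reg_l (t ^ 2 * P ^ 2)); [|nra].
      rewrite Rinv_r by nra. rewrite <- U2. ring. }
    rewrite R0.
    (* Under the Robin condition [t u' = delta u], the energy is a multiple of [u^2]. *)
    transitivity ((t ^ 2 - (nu ^ 2 - delta ^ 2)) * u t ^ 2); [field; lra|].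
    rewrite V2. field. lra. }
  pose proof (bessel_energy_lt nu a b u u' Hu (conj Ha Hab) Hnz) as L.
  rewrite (K a Ha) in L by (rewrite Rminus_diag; apply sin_0).
  rewrite (K b ltac:(lra) Hs) in L. unfold a, b in L |- *.
  apply (Rmult_lt_reg_l x); [easy|]. nra.
Qed.

(** * Bound of the phase gap by a half turn near 0 *)

Lemma constant_sign_pos (m : R -> R) (eps : R) :
  (forall t, 0 < t -> continuity_pt m t) -> (forall t, 0 < t < eps -> m t <> 0) ->
  forall a b, 0 < a < eps -> 0 < b < eps -> 0 < m a * m b.
Proof.
  intros Hc Hn.
  assert (W : forall a b, 0 < a < eps -> 0 < b < eps -> ~ (m a <= 0 <= m b)).
  { intros a b Ha Hb E.
    destruct (IVT_pos m a b 0 Hc ltac:(lra) ltac:(lra) E) as (z & Hz & Ez).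
    apply (Hn z); [|easy].
    pose proof (Rmin_glb_lt a b 0 ltac:(lra) ltac:(lra)).
    pose proof (Rmax_lub_lt a b eps ltac:(lra) ltac:(lra)). lra. }
  intros a b Ha Hb. pose proof (W a b Ha Hb). pose proof (W b a Hb Ha).
  pose proof (Hn a Ha). pose proof (Hn b Hb).
  destruct (Rlt_le_dec (m a) 0), (Rlt_le_dec (m b) 0); try nra; exfalso; lra.
Qed.

(** The nonvanishing combination equals [P (p cos theta + q sin theta)]. If theta advanced by PI,
    the second factor would change sign, hence vanish somewhere in between. *)
Lemma phase_gap_lt_PI (nu delta eps p q : R) (u1 u1' u2 u2' theta : R -> R) :
  is_phase nu delta u1 u1' u2 u2' theta ->
  (forall t, 0 < t < eps -> p * robin delta u1 u1' t + q * robin delta u2 u2' t <> 0) ->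
  forall a b, 0 < a < eps -> 0 < b < eps -> theta b - theta a < PI.
Proof.
  intros H Hn a b Ha Hb.
  assert (Hth : forall t, 0 < t -> continuity_pt theta t).
  { intros t Ht. eapply is_derive_continuity_pt. now apply H. }
  set (m := fun t => p * cos (theta t) + q * sin (theta t)).
  assert (Hm : forall t, 0 < t -> continuity_pt m t).
  { intros t Ht. destruct (H t Ht) as [D _].
    apply (is_derive_continuity_pt _ _ (Derive m t)). apply Derive_correct.
    unfold m. auto_derive. repeat split; eexists; exact D. }
  assert (Hm0 : forall t, 0 < t < eps -> m t <> 0).
  { intros t Ht Z. apply (Hn t Ht).
    destruct (phase_polar _ _ _ _ _ _ _ t H ltac:(lra)) as (P & _ & Pc & Ps).
    rewrite Pc, Ps. transitivity (P * m t); [unfold m; ring|]. rewrite Z. ring. }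
  destruct (Rlt_le_dec (theta b - theta a) PI) as [L|L]; [easy|exfalso].
  destruct (IVT_pos theta a b (theta a + PI) Hth) as (z & Hz & Ez); try lra.
  { pose proof PI_RGT_0. lra. }
  assert (Hz' : 0 < z < eps).
  { pose proof (Rmin_glb_lt a b 0 ltac:(lra) ltac:(lra)).
    pose proof (Rmax_lub_lt a b eps ltac:(lra) ltac:(lra)). lra. }
  pose proof (constant_sign_pos m eps Hm Hm0 a z Ha Hz') as S.
  assert (m z = - m a) by (unfold m; rewrite Ez, neg_cos, neg_sin; ring).
  nra.
Qed.

(** * Asymptotics of the phase *)

Lemma sin_ge_half (x : R) : 0 <= x <= PI / 2 -> x / 2 <= sin x.
Proof.
  intros Hx. pose proof PI_RGT_0.
  assert (K : forall y, 0 <= y <= PI / 2 -> y * cos y <= sin y).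
  { intros y Hy. destruct (MVT_gen sin 0 y cos) as [c [Hc E]].
    - intros t _. apply is_derive_sin.
    - intros t _. apply continuity_sin.
    - rewrite Rmin_left, Rmax_right in Hc by lra. rewrite sin_0 in E.
      assert (cos y <= cos c) by (apply cos_decr_1; lra). nra. }
  (* By the double angle formulas [sin x = 2 sin (x/2) cos (x/2) >= x cos (x/2)^2], and
     [2 cos (x/2)^2 = 1 + cos x >= 1]. *)
  specialize (K (x / 2) ltac:(lra)).
  replace x with (2 * (x / 2)) at 2 by field. rewrite sin_2a.
  assert (0 <= cos x) by (apply cos_ge_0; lra).
  replace x with (2 * (x / 2)) in H0 at 1 by field. rewrite cos_2a_cos in H0.
  assert (0 <= cos (x / 2)) by (apply cos_ge_0; lra). nra.
Qed.

Lemma Rabs_sin_ge_half (x : R) : Rabs x <= PI / 2 -> Rabs x <= 2 * Rabs (sin x).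
Proof.
  intros H. destruct (Rle_dec 0 x) as [Hx|Hx].
  - rewrite Rabs_pos_eq in H |- * by easy.
    pose proof (sin_ge_half x ltac:(lra)). pose proof (Rle_abs (sin x)). lra.
  - rewrite Rabs_left in H |- * by lra.
    pose proof (sin_ge_half (- x) ltac:(lra)) as S. rewrite sin_neg in S.
    pose proof (Rle_abs (- sin x)) as T. rewrite Rabs_Ropp in T. lra.
Qed.

(** Once the cosine stays away from 1 in absolute value, continuity traps [f] between two
    consecutive multiples of PI. There the distance to the midpoint [l] is at most twice
    [|cos f|]. *)
Lemma cos_small_converges (f : R -> R) (C : R) :
  (forall t, 0 < t -> continuity_pt f t) -> (forall t, 1 <= t -> Rabs (cos (f t)) <= C / t) ->
  exists l T K, 1 <= T /\ forall t, T <= t -> Rabs (f t - l) <= K / t.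
Proof.
  intros Hc H. pose proof PI_RGT_0 as Hpi.
  assert (HC : 0 <= C).
  { specialize (H 1 ltac:(lra)). pose proof (Rabs_pos (cos (f 1))).
    replace (C / 1) with C in H by field. lra. }
  set (T := 2 * C + 1).
  destruct (floor_ex (f T / PI)) as [k Hk].
  set (l := IZR k * PI + PI / 2).
  assert (El : forall t, Rabs (sin (f t - l)) = Rabs (cos (f t))).
  { intros t. replace (cos (f t)) with (cos ((f t - l) + IZR k * PI + PI / 2))
      by (f_equal; unfold l; ring).
    assert (Zk : sin (IZR k * PI) = 0) by (apply sin_eq_0_1; now exists k).
    rewrite cos_plus, cos_PI2, sin_PI2, sin_plus, Zk.
    assert (Ck : Rabs (cos (IZR k * PI)) = 1).
    { pose proof (sin2_cos2 (IZR k * PI)) as X. unfold Rsqr in X. rewrite Zk in X.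
      assert (Y : (cos (IZR k * PI) - 1) * (cos (IZR k * PI) + 1) = 0) by lra.
      destruct (Rmult_integral _ _ Y) as [Z|Z].
      - replace (cos (IZR k * PI)) with 1 by lra. apply Rabs_R1.
      - replace (cos (IZR k * PI)) with (-1) by lra. rewrite Rabs_left; lra. }
    match goal with |- _ = Rabs ?z => replace z with (- (sin (f t - l) * cos (IZR k * PI))) by ring end.
    rewrite Rabs_Ropp, Rabs_mult, Ck. ring. }
  assert (HT : Rabs (f T - l) <= PI / 2).
  { assert (E : f T = f T / PI * PI) by (field; lra).
    apply Rabs_le. unfold l. rewrite E. nra. }
  assert (Hs : forall t, T <= t -> Rabs (sin (f t - l)) <= 1 / 2).
  { intros t Ht. rewrite El. eapply Rle_trans; [apply H; unfold T in Ht; lra|].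
    apply Rle_div_l; unfold T in Ht; lra. }
  assert (H2 : forall t, T <= t -> Rabs (f t - l) <= PI / 2).
  { intros t Ht. apply Rabs_le_between in HT.
    destruct (Rle_dec (Rabs (f t - l)) (PI / 2)) as [L|L]; [easy|exfalso].
    assert (HT0 : 0 < T) by (unfold T; lra).
    assert (X : exists z, T <= z /\ (f z - l = PI / 2 \/ f z - l = - (PI / 2))).
    { destruct (Rle_dec 0 (f t - l)) as [P|P].
      - rewrite Rabs_pos_eq in L by easy.
        destruct (IVT_pos f T t (l + PI / 2) Hc) as (z & Hz & Ez); try lra.
        rewrite Rmin_left in Hz by easy. exists z. split; [easy|left; lra].
      - rewrite Rabs_left in L by lra.
        destruct (IVT_pos f t T (l - PI / 2) Hc) as (z & Hz & Ez); try lra.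
        rewrite Rmin_right in Hz by easy. exists z. split; [easy|right; lra]. }
    destruct X as (z & Hz & Ez). specialize (Hs z Hz).
    destruct Ez as [Ez|Ez]; rewrite Ez in Hs.
    - rewrite sin_PI2, Rabs_R1 in Hs. lra.
    - rewrite sin_neg, sin_PI2, Rabs_Ropp, Rabs_R1 in Hs. lra. }
  exists l, T, (2 * C). split; [unfold T; lra|]. intros t Ht.
  pose proof (Rabs_sin_ge_half _ (H2 t Ht)) as X. rewrite El in X.
  specialize (H t ltac:(unfold T in Ht; lra)). unfold Rdiv in *. lra.
Qed.

(** The Robin derivatives, scaled by [sqrt t], approach [- sin t] and [cos t]. The direction of the
    curve is thus that of [t + PI/2] up to [O(1/t)], which says that [cos (theta t - t)] is
    small. *)
Lemma phase_asymptotics (nu delta : R) (u1 u1' u2 u2' theta : R -> R) :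
  is_phase nu delta u1 u1' u2 u2' theta ->
  bessel_asymptotics u1 u1' 1 0 -> bessel_asymptotics u2 u2' 0 1 ->
  exists l T K, 1 <= T /\ forall t, T <= t -> Rabs (theta t - t - l) <= K / t.
Proof.
  intros H [C1 A1] [C2 A2].
  (* [sqrt t * robin] differs from the derivative of [sqrt t * u] by [(delta + 1/2) / t] times the
     bounded function [sqrt t * u], so [delta] affects only the error term. *)
  assert (B : forall (u u' : R -> R) C A B', (forall t, 1 <= t ->
      Rabs (sqrt t * u t - (A * cos t + B' * sin t)) <= C / t /\
      Rabs (sqrt t * u' t + u t / (2 * sqrt t) - (B' * cos t - A * sin t)) <= C / t) ->
    exists D, forall t, 1 <= t ->
      Rabs (sqrt t * robin delta u u' t - (B' * cos t - A * sin t)) <= D / t).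
  { intros u u' C A B' HC.
    exists (C + Rabs (delta + 1 / 2) * (C + Rabs A + Rabs B')). intros t Ht.
    destruct (HC t Ht) as [X Y]. pose proof (sqrt_lt_R0 t ltac:(lra)) as Hq.
    assert (Et : sqrt t * sqrt t = t) by (apply sqrt_sqrt; lra).
    assert (Hit : 0 < / t <= 1).
    { split; [apply Rinv_0_lt_compat; lra|]. rewrite <- Rinv_1. apply Rinv_le_contravar; lra. }
    assert (HC0 : 0 <= C).
    { pose proof (Rle_trans _ _ _ (Rabs_pos _) X) as Z. unfold Rdiv in Z. nra. }
    assert (Z : Rabs (sqrt t * u t) <= C + Rabs A + Rabs B').
    { replace (sqrt t * u t) with ((sqrt t * u t - (A * cos t + B' * sin t)) +
        (A * cos t + B' * sin t)) by ring.
      eapply Rle_trans; [apply Rabs_triang|].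
      pose proof (Rabs_triang (A * cos t) (B' * sin t)) as Z1.
      pose proof (Rabs_mult_le A (cos t) (Rabs A) 1 ltac:(lra) (Rabs_cos_le_1 t)).
      pose proof (Rabs_mult_le B' (sin t) (Rabs B') 1 ltac:(lra) (Rabs_sin_le_1 t)).
      assert (C / t <= C) by (unfold Rdiv; nra). lra. }
    replace (sqrt t * robin delta u u' t - (B' * cos t - A * sin t)) with
      ((sqrt t * u' t + u t / (2 * sqrt t) - (B' * cos t - A * sin t))
       + - ((delta + 1 / 2) * (/ t * (sqrt t * u t)))).
    - eapply Rle_trans; [apply Rabs_triang|]. rewrite Rabs_Ropp.
      assert (Z2 : Rabs (/ t * (sqrt t * u t)) <= / t * (C + Rabs A + Rabs B')).
      { apply Rabs_mult_le; [|easy]. rewrite Rabs_pos_eq; lra. }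
      pose proof (Rabs_mult_le (delta + 1 / 2) _ _ _ (Rle_refl _) Z2).
      unfold Rdiv in *. lra.
    - assert (Ei : u t / (2 * sqrt t) = 1 / 2 * (/ t * (sqrt t * u t))).
      { replace (/ t) with (/ (sqrt t * sqrt t)) by now rewrite Et. field. lra. }
      rewrite Ei. unfold robin. field. lra. }
  destruct (B _ _ _ _ _ A1) as [D1 B1]. destruct (B _ _ _ _ _ A2) as [D2 B2].
  destruct (cos_small_converges (fun t => theta t - t) (D1 + D2)) as (l & T & K & HT & HK).
  - intros t Ht. apply continuity_pt_minus.
    + eapply is_derive_continuity_pt. now apply H.
    + apply derivable_continuous_pt, derivable_pt_id.
  - intros t Ht. destruct (H t ltac:(lra)) as [_ E].
    specialize (B1 t Ht). specialize (B2 t Ht).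
    rewrite cos_minus.
    replace (cos (theta t) * cos t + sin (theta t) * sin t) with
      ((sqrt t * robin delta u1 u1' t - (0 * cos t - 1 * sin t)) * sin (theta t)
       + - (sqrt t * robin delta u2 u2' t - (1 * cos t - 0 * sin t)) * cos (theta t)).
    + eapply Rle_trans; [apply Rabs_triang|].
      replace ((D1 + D2) / t) with (D1 / t * 1 + D2 / t * 1) by (field; lra).
      apply Rplus_le_compat; apply Rabs_mult_le; rewrite ?Rabs_Ropp;
        auto using Rabs_sin_le_1, Rabs_cos_le_1.
    + transitivity (sqrt t * (robin delta u1 u1' t * sin (theta t)
        - robin delta u2 u2' t * cos (theta t)) + sin t * sin (theta t) + cos t * cos (theta t));
        [ring|]. rewrite E. ring.
  - now exists l, T, K.
Qed.

(** * Level crossings and enumeration of the zeros *)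

Lemma derive_local_crossing (f : R -> R) (s d L : R) :
  is_derive f s d -> (f s = L -> 0 < d) ->
  exists eps, 0 < eps /\ forall h, 0 < h < eps ->
    (L <= f s -> L < f (s + h)) /\ (f s <= L -> f (s - h) < L).
Proof.
  intros D Hd. destruct (Req_dec (f s) L) as [E|E].
  - specialize (Hd E). apply is_derive_Reals in D.
    destruct (D d Hd) as [eps He]. exists eps. split; [apply cond_pos|]. intros h Hh.
    assert (Q : forall k, k <> 0 -> Rabs k < eps -> 0 < (f (s + k) - f s) / k).
    { intros k Hk0 Hk. specialize (He k Hk0 Hk). apply Rabs_def2 in He. lra. }
    split; intros _.
    + specialize (Q h ltac:(lra) ltac:(rewrite Rabs_pos_eq; lra)).
      assert (X : f (s + h) - f s = (f (s + h) - f s) / h * h) by (field; lra). nra.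
    + specialize (Q (- h) ltac:(lra) ltac:(rewrite Rabs_left; lra)).
      change (s - h) with (s + - h).
      assert (X : f (s + - h) - f s = (f (s + - h) - f s) / - h * - h) by (field; lra). nra.
  - apply is_derive_continuity_pt in D.
    destruct (D (Rabs (f s - L))) as (eps & He & H).
    { apply Rabs_pos_lt. lra. }
    exists eps. split; [easy|]. intros h Hh.
    assert (Q : forall y, y <> s -> Rabs (y - s) < eps -> Rabs (f y - f s) < Rabs (f s - L)).
    { intros y Hy1 Hy2. apply H. split; [split; [exact I|now apply not_eq_sym]|exact Hy2]. }
    split; intros HL.
    + specialize (Q (s + h) ltac:(lra)). replace (s + h - s) with h in Q by ring.
      specialize (Q ltac:(rewrite Rabs_pos_eq; lra)).
      rewrite (Rabs_pos_eq (f s - L)) in Q by lra. apply Rabs_def2 in Q. lra.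
    + specialize (Q (s - h) ltac:(lra)). replace (s - h - s) with (- h) in Q by ring.
      specialize (Q ltac:(rewrite Rabs_left; lra)).
      rewrite (Rabs_left (f s - L)) in Q by lra. apply Rabs_def2 in Q. lra.
Qed.

(** If [f x1 <= L], then [f] is already strictly below [L] at some [y] just left of [x1]. The
    supremum [s] of the points of [[x0, y]] with [f >= L] is then contradictory: if [f s < L], the
    supremum could be lowered; if [f s >= L], such points would lie beyond it. *)
Lemma upward_crossing (f f' : R -> R) (L x0 x1 : R) :
  (forall x, 0 < x -> is_derive f x (f' x)) -> (forall x, 0 < x -> f x = L -> 0 < f' x) ->
  0 < x0 < x1 -> L <= f x0 -> L < f x1.
Proof.
  intros D Hd Hx H0. destruct (Rlt_le_dec L (f x1)) as [X|X]; [easy|exfalso].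
  destruct (derive_local_crossing f x1 _ L (D x1 ltac:(lra)) (Hd x1 ltac:(lra)))
    as (e1 & He1 & C1).
  set (h1 := Rmin (e1 / 2) ((x1 - x0) / 2)).
  assert (Hh1 : 0 < h1 /\ h1 < e1 /\ h1 < x1 - x0).
  { unfold h1. pose proof (Rmin_l (e1 / 2) ((x1 - x0) / 2)).
    pose proof (Rmin_r (e1 / 2) ((x1 - x0) / 2)).
    pose proof (Rmin_glb_lt (e1 / 2) ((x1 - x0) / 2) 0 ltac:(lra) ltac:(lra)). lra. }
  destruct (C1 h1 ltac:(lra)) as [_ Y]. specialize (Y X).
  set (y := x1 - h1) in *. assert (Hy : x0 < y < x1) by (unfold y; lra).
  destruct (completeness (fun x => x0 <= x <= y /\ L <= f x)) as [s [Hu Hl]].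
  - exists y. intros x [Hx' _]. lra.
  - exists x0. split; lra.
  - assert (Hs0 : x0 <= s) by (apply Hu; split; lra).
    assert (Hs1 : s <= y) by (apply Hl; intros x [Hx' _]; lra).
    destruct (derive_local_crossing f s _ L (D s ltac:(lra)) (Hd s ltac:(lra)))
      as (e & He & Cs).
    destruct (Rlt_le_dec (f s) L) as [Z|Z].
    + assert (s <= s - e); [|lra].
      apply Hl. intros x [Hx1 Hx2].
      assert (x <= s) by now apply Hu.
      destruct (Rle_dec x (s - e)) as [W|W]; [easy|exfalso].
      destruct (Req_dec x s) as [E|E]; [subst x; lra|].
      destruct (Cs (s - x) ltac:(lra)) as [_ V].
      replace (s - (s - x)) with x in V by ring. lra.
    + assert (s <> y) by (intros E; subst s; lra).
      set (h := Rmin (e / 2) (y - s)).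
      assert (Hh : 0 < h /\ h < e /\ h <= y - s).
      { unfold h. pose proof (Rmin_l (e / 2) (y - s)). pose proof (Rmin_r (e / 2) (y - s)).
        pose proof (Rmin_glb_lt (e / 2) (y - s) 0 ltac:(lra) ltac:(lra)). lra. }
      destruct (Cs h ltac:(lra)) as [V _]. specialize (V Z).
      assert (s + h <= s); [|lra]. apply Hu. split; lra.
Qed.

(** Each [z k] equals some [w j], and induction on [k] gives [j >= k], since [j] grows strictly with
    [k]. *)
Lemma enumeration_le (z w : nat -> R) (k0 : nat) :
  (forall k, (k0 <= k)%nat -> z k < z (S k)) -> (forall k, (k0 <= k)%nat -> w k < w (S k)) ->
  (forall k, (k0 <= k)%nat -> exists j, (k0 <= j)%nat /\ w j = z k) ->
  forall k, (k0 <= k)%nat -> w k <= z k.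
Proof.
  intros Hz Hw H.
  assert (M : forall i j, (k0 <= i)%nat -> (i <= j)%nat -> w i <= w j).
  { intros i j Hi Hij. induction Hij as [|j Hij IH]; [lra|].
    specialize (Hw j ltac:(lia)). lra. }
  assert (K : forall k, (k0 <= k)%nat -> exists j, (k <= j)%nat /\ w j = z k).
  { intros k Hk. induction Hk as [|k Hk IH].
    - now apply H.
    - destruct IH as (j & Hj & Ej). destruct (H (S k) ltac:(lia)) as (j' & Hj' & Ej').
      exists j'. split; [|easy]. specialize (Hz k Hk).
      destruct (Nat.le_gt_cases j' j) as [L|L]; [|lia].
      pose proof (M j' j Hj' L). lra. }
  intros k Hk. destruct (K k Hk) as (j & Hj & Ej). rewrite <- Ej. now apply M.
Qed.

Lemma lists_positive_zeros_unique (f : R -> R) (k0 : nat) (z w : nat -> R) :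
  lists_positive_zeros f k0 z -> lists_positive_zeros f k0 w ->
  forall k, (k0 <= k)%nat -> z k = w k.
Proof.
  intros [Z1 Z2] [W1 W2] k Hk. apply Rle_antisym.
  - apply (enumeration_le w z k0); try easy. intros j Hj. apply Z2, W2. now exists j.
  - apply (enumeration_le z w k0); try easy. intros j Hj. apply W2, Z2. now exists j.
Qed.


(** Near 0, [D] lies between the levels [k0 - 1] and [k0]. Levels up to [k0 - 1] are already passed
    from below and never met again; each level from [k0] on is reached, since [D] grows like [a x],
    and only once. The zero of index [k] thus solves [D x = k PI], and the expansion of [D] is
    inverted there. *)
Lemma phase_gap_zeros (f D D' : R -> R) (k0 : nat) (a C X0 : R) :
  (forall x, 0 < x -> f x = 0 <-> sin (D x) = 0) ->
  (forall x, 0 < x -> is_derive D x (D' x)) ->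
  (forall x, 0 < x -> sin (D x) = 0 -> 0 < D' x) ->
  (exists eps, 0 < eps /\ forall x, 0 < x < eps -> (INR k0 - 1) * PI < D x < INR k0 * PI) ->
  0 < a -> 1 <= X0 -> (forall x, X0 <= x -> Rabs (D x - a * x) <= C / x) ->
  (exists z, lists_positive_zeros f k0 z) /\
  (forall z, lists_positive_zeros f k0 z ->
     exists (M : R) (K : nat), forall k : nat, (K <= k)%nat -> (0 < k)%nat ->
       Rabs (z k - PI / a * INR k) <= M * (1 / INR k)).
Proof.
  intros Hf HD HD' (eps & Heps & H0) Ha HX0 Has.
  pose proof PI_RGT_0 as Hpi.
  assert (HC : 0 <= C).
  { pose proof (Rle_trans _ _ _ (Rabs_pos _) (Has X0 (Rle_refl _))) as Y.
    assert (0 < / X0) by (apply Rinv_0_lt_compat; lra). unfold Rdiv in Y. nra. }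
  assert (Hc : forall x, 0 < x -> continuity_pt D x).
  { intros x Hx. eapply is_derive_continuity_pt. now apply HD. }
  assert (Up : forall (m : Z) x0 x1, 0 < x0 < x1 -> IZR m * PI <= D x0 -> IZR m * PI < D x1).
  { intros m x0 x1 Hx. apply (upward_crossing D D'); try easy.
    intros x Hx' E. apply HD'; [easy|]. apply sin_eq_0_1. now exists m. }
  assert (UpN : forall (k : nat) x0 x1, 0 < x0 < x1 -> INR k * PI <= D x0 -> INR k * PI < D x1).
  { intros k. rewrite INR_IZR_INZ. apply Up. }
  assert (Ex : forall k, (k0 <= k)%nat -> exists x, 0 < x /\ D x = INR k * PI).
  { intros k Hk. apply le_INR in Hk.
    (* At [X] the main term [a X] exceeds [k PI] by more than [C], which bounds the error
       [C / X]. *)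
    set (X := X0 + (INR k * PI + C) / a).
    assert (Hp : 0 <= (INR k * PI + C) / a).
    { apply Rmult_le_pos; [|left; now apply Rinv_0_lt_compat].
      pose proof (pos_INR k). nra. }
    assert (HX : X0 <= X) by (unfold X; lra).
    assert (HDX : INR k * PI <= D X).
    { pose proof (Has X HX) as Y. apply Rabs_le_between in Y.
      assert (C / X <= C).
      { apply Rle_div_l; [lra|]. nra. }
      assert (a * X = a * X0 + INR k * PI + C) by (unfold X; field; lra). nra. }
    pose proof (H0 (eps / 2) ltac:(lra)) as Hy.
    destruct (IVT_pos D (eps / 2) X (INR k * PI) Hc) as (z & Hz & Ez); try nra.
    exists z. split; [|easy].
    pose proof (Rmin_glb_lt (eps / 2) X 0 ltac:(lra) ltac:(lra)). lra. }
  (* A value is characterized only for [k >= k0]; below that it is arbitrary, as the listing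
     permits. *)
  set (w := fun k => epsilon (inhabits 0) (fun x => 0 < x /\ D x = INR k * PI)).
  assert (Hw : forall k, (k0 <= k)%nat -> 0 < w k /\ D (w k) = INR k * PI).
  { intros k Hk. apply (epsilon_spec (inhabits 0) (fun x => 0 < x /\ D x = INR k * PI)).
    now apply Ex. }
  assert (Lw : lists_positive_zeros f k0 w).
  { split.
    - intros k Hk. destruct (Hw k Hk) as [P1 E1]. destruct (Hw (S k) ltac:(lia)) as [P2 E2].
      rewrite S_INR in E2.
      destruct (Rlt_le_dec (w k) (w (S k))) as [L|[L|L]]; [easy|exfalso..].
      + pose proof (UpN k _ _ (conj P2 L) ltac:(lra)). lra.
      + rewrite <- L in E1. lra.
    - intros x. split.
      + intros [Hx E]. apply Hf in E; [|easy].
        destruct (sin_eq_0_0 _ E) as [m Em].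
        assert (Hm : (Z.of_nat k0 <= m)%Z).
        { destruct (Z_le_gt_dec (Z.of_nat k0) m) as [L|L]; [easy|exfalso].
          assert (Lm : IZR m <= INR k0 - 1).
          { rewrite INR_IZR_INZ, <- minus_IZR. apply IZR_le. lia. }
          (* A point left of [x] at which [D] is already above level [m]. *)
          set (y := Rmin (eps / 2) (x / 2)).
          assert (Hy : 0 < y /\ y < eps /\ y < x).
          { unfold y. pose proof (Rmin_l (eps / 2) (x / 2)). pose proof (Rmin_r (eps / 2) (x / 2)).
            pose proof (Rmin_glb_lt (eps / 2) (x / 2) 0 ltac:(lra) ltac:(lra)). lra. }
          pose proof (H0 y ltac:(lra)) as Hy'.
          pose proof (Up m y x ltac:(lra) ltac:(nra)). lra. }
        exists (Z.to_nat m). split; [lia|].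
        destruct (Hw (Z.to_nat m) ltac:(lia)) as [P1 E1].
        assert (Em' : D x = INR (Z.to_nat m) * PI).
        { rewrite INR_IZR_INZ, Z2Nat.id by lia. exact Em. }
        destruct (Rtotal_order (w (Z.to_nat m)) x) as [L|[L|L]]; [exfalso|easy|exfalso].
        * pose proof (UpN _ _ _ (conj P1 L) (Req_le _ _ (eq_sym E1))). lra.
        * pose proof (UpN _ _ _ (conj Hx L) (Req_le _ _ (eq_sym Em'))). lra.
      + intros (k & Hk & E). subst x. destruct (Hw k Hk) as [P1 E1].
        split; [easy|]. apply Hf; [easy|]. rewrite E1. apply sin_eq_0_1.
        exists (Z.of_nat k). now rewrite <- INR_IZR_INZ. }
  split; [now exists w|].
  intros z Lz.
  (* For [k > |D X0| + C] the level [k PI] lies above [D X0], so the zero lies beyond [X0], where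
     the expansion holds. *)
  destruct (nfloor_ex (Rabs (D X0) + C)) as [N [HN1 HN2]].
  { pose proof (Rabs_pos (D X0)); lra. }
  exists C, (k0 + S N)%nat. intros k Hk Hk0.
  rewrite (lists_positive_zeros_unique _ _ _ _ Lz Lw k ltac:(lia)).
  destruct (Hw k ltac:(lia)) as [P1 E1].
  assert (HkN : Rabs (D X0) + C < INR k).
  { assert (L : (S N <= k)%nat) by lia. apply le_INR in L. rewrite S_INR in L. lra. }
  pose proof (Rabs_pos (D X0)). pose proof PI2_1 as Hpi2.
  assert (HX : X0 < w k).
  { destruct (Rlt_le_dec X0 (w k)) as [L|L]; [easy|exfalso].
    assert (INR k * PI <= D X0).
    { destruct L as [L|L]; [|rewrite <- L; lra].
      left. apply (UpN k (w k) X0); lra. }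
    pose proof (Rle_abs (D X0)). nra. }
  pose proof (Has (w k) ltac:(lra)) as Y. rewrite E1 in Y.
  assert (HCw : C / w k <= C) by (apply Rle_div_l; nra).
  (* [PI > 2] and [k > C] give [a w k >= k PI - C >= k]. The error [C / (a w k)] is then at most
     [C / k]. *)
  assert (Hwk : INR k <= a * w k).
  { apply Rabs_le_between in Y. nra. }
  replace (w k - PI / a * INR k) with (- ((INR k * PI - a * w k) / a)) by (field; lra).
  rewrite Rabs_Ropp, Rabs_div, (Rabs_pos_eq a) by lra.
  apply Rle_div_l; [easy|].
  eapply Rle_trans; [exact Y|].
  apply Rle_div_l; [easy|].
  replace (C * (1 / INR k) * a * w k) with (C * ((a * w k) / INR k)) by (field; lra).
  assert (1 <= a * w k / INR k) by (apply Rle_div_r; lra). nra.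
Qed.

(** * The phase gap of Bessel solutions *)

Lemma Derive_Rpower_mult (delta t : R) (f f' : R -> R) : 0 < t -> is_derive f t (f' t) ->
  Derive (fun x => Rpower x (- delta) * f x) t = Rpower t (- delta) * robin delta f f' t.
Proof.
  intros Ht H. apply is_derive_unique. unfold Rpower, robin. auto_derive.
  - repeat split; [easy|eexists; exact H].
  - change (Derive (fun x => f x) t) with (Derive f t).
    rewrite (is_derive_unique _ _ _ H). field. lra.
Qed.

Lemma is_derive_phase_gap (nu delta rin rout x : R) (u1 u1' u2 u2' theta : R -> R) :
  is_phase nu delta u1 u1' u2 u2' theta -> 0 < rin < rout -> 0 < x ->
  is_derive (phase_gap rin rout theta) x
    (rout * phase_speed nu delta u1 u1' u2 u2' (rout * x)
     - rin * phase_speed nu delta u1 u1' u2 u2' (rin * x)).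
Proof.
  intros H Hr Hx.
  destruct (H (rout * x) ltac:(nra)) as [D1 _]. destruct (H (rin * x) ltac:(nra)) as [D2 _].
  unfold phase_gap. auto_derive.
  - repeat split; eexists; eassumption.
  - change (Derive (fun x => theta x)) with (Derive theta).
    rewrite (is_derive_unique _ _ _ D1), (is_derive_unique _ _ _ D2). ring.
Qed.

Lemma phase_gap_mean_value (nu delta rin rout x : R) (u1 u1' u2 u2' theta : R -> R) :
  is_phase nu delta u1 u1' u2 u2' theta -> 0 < rin < rout -> 0 < x ->
  exists c, rin * x <= c <= rout * x /\
    phase_gap rin rout theta x = phase_speed nu delta u1 u1' u2 u2' c * ((rout - rin) * x).
Proof.
  intros H Hr Hx. assert (L : rin * x < rout * x) by nra. assert (P : 0 < rin * x) by nra.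
  destruct (MVT_gen theta (rin * x) (rout * x) (phase_speed nu delta u1 u1' u2 u2')) as [c [Hc E]].
  - intros t Ht. rewrite Rmin_left in Ht by lra. apply H. lra.
  - intros t Ht. rewrite Rmin_left in Ht by lra.
    eapply is_derive_continuity_pt. apply H. lra.
  - rewrite Rmin_left, Rmax_right in Hc by lra. exists c. split; [easy|].
    unfold phase_gap. rewrite E. ring.
Qed.

(** The nonvanishing combination bounds the gap by PI in both directions. Its sign is that of
    [phase_speed] at an intermediate point, so it lies in [(-PI, 0)] or in [(0, PI)] according to
    the value of [first_index]. *)
Lemma phase_gap_near_0 (nu delta rin rout eps p q : R) (u1 u1' u2 u2' theta : R -> R) :
  normalized_pair nu u1 u1' u2 u2' -> is_phase nu delta u1 u1' u2 u2' theta ->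
  0 < rin < rout -> Rabs delta <= nu -> 0 < eps ->
  (forall t, 0 < t < eps -> p * robin delta u1 u1' t + q * robin delta u2 u2' t <> 0) ->
  exists e, 0 < e /\ forall x, 0 < x < e ->
    (INR (first_index nu delta) - 1) * PI < phase_gap rin rout theta x
    < INR (first_index nu delta) * PI.
Proof.
  intros Hn H Hr Hd He Hnz.
  assert (B : forall x, 0 < x < eps / rout -> - PI < phase_gap rin rout theta x < PI).
  { intros x [Hx0 Hx]. apply Rlt_div_r in Hx; [|lra].
    assert (L : 0 < rin * x < eps) by nra. assert (L' : 0 < rout * x < eps) by nra.
    pose proof (phase_gap_lt_PI nu delta eps p q _ _ _ _ _ H Hnz _ _ L L').
    pose proof (phase_gap_lt_PI nu delta eps p q _ _ _ _ _ H Hnz _ _ L' L).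
    unfold phase_gap. lra. }
  assert (He' : 0 < eps / rout) by (apply Rdiv_lt_0_compat; lra).
  assert (S : forall c, 0 < c -> exists k, 0 < k /\
    phase_speed nu delta u1 u1' u2 u2' c = k * (c ^ 2 - (nu ^ 2 - delta ^ 2))).
  { intros c Hc. pose proof (robin_pos nu delta c _ _ _ _ Hn Hc) as Hp.
    exists (/ (c ^ 3 * (robin delta u1 u1' c ^ 2 + robin delta u2 u2' c ^ 2))). split.
    - apply Rinv_0_lt_compat, Rmult_lt_0_compat; [now apply pow_lt|easy].
    - unfold phase_speed. field. lra. }
  unfold first_index. destruct (Rlt_dec (Rabs delta) nu) as [L|L]; simpl INR.
  - assert (C2 : 0 < nu ^ 2 - delta ^ 2).
    { rewrite <- (pow2_abs delta). pose proof (Rabs_pos delta). nra. }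
    (* The phase decreases up to [c0]; [x < c0 / rout] keeps both arguments below it. *)
    set (c0 := sqrt (nu ^ 2 - delta ^ 2)).
    assert (Hc0 : 0 < c0) by now apply sqrt_lt_R0.
    assert (Ec0 : c0 * c0 = nu ^ 2 - delta ^ 2) by (apply sqrt_sqrt; lra).
    assert (Hc1 : 0 < c0 / rout) by (apply Rdiv_lt_0_compat; lra).
    exists (Rmin (eps / rout) (c0 / rout)). split; [now apply Rmin_glb_lt|].
    intros x [Hx0 Hx].
    pose proof (Rmin_l (eps / rout) (c0 / rout)). pose proof (Rmin_r (eps / rout) (c0 / rout)).
    assert (Hx' : x < c0 / rout) by lra. apply Rlt_div_r in Hx'; [|lra].
    specialize (B x ltac:(lra)).
    destruct (phase_gap_mean_value _ _ rin rout x _ _ _ _ _ H Hr Hx0) as (c & Hc & E).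
    assert (Hcp : 0 < c < c0) by (split; nra).
    destruct (S c (proj1 Hcp)) as (k & Hk & Ek). rewrite Ek in E.
    assert (0 < (rout - rin) * x) by nra.
    assert (c ^ 2 - (nu ^ 2 - delta ^ 2) < 0) by (rewrite <- Ec0; nra).
    assert (k * (c ^ 2 - (nu ^ 2 - delta ^ 2)) < 0) by nra.
    nra.
  - exists (eps / rout). split; [easy|]. intros x Hx. specialize (B x Hx).
    assert (C2 : nu ^ 2 - delta ^ 2 = 0).
    { rewrite <- (pow2_abs delta). replace (Rabs delta) with nu by lra. ring. }
    destruct (phase_gap_mean_value _ _ rin rout x _ _ _ _ _ H Hr (proj1 Hx)) as (c & Hc & E).
    assert (Hc0 : 0 < c) by nra.
    destruct (S c Hc0) as (k & Hk & Ek). rewrite Ek, C2, Rminus_0_r in E.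
    assert (0 < (rout - rin) * x) by nra.
    assert (0 < k * c ^ 2) by (apply Rmult_lt_0_compat; [easy|now apply pow_lt]).
    nra.
Qed.

(** The limit constant [l] is common to both arguments and cancels, which is why the expansion of
    the zeros has no constant term. *)
Lemma phase_gap_asymptotics (rin rout l T K : R) (theta : R -> R) :
  0 < rin < rout -> (forall t, T <= t -> Rabs (theta t - t - l) <= K / t) ->
  exists C X0, 1 <= X0 /\ forall x, X0 <= x ->
    Rabs (phase_gap rin rout theta x - (rout - rin) * x) <= C / x.
Proof.
  intros Hr H. exists (K / rout + K / rin), (1 + Rabs T / rin).
  assert (P : 0 <= Rabs T / rin).
  { apply Rmult_le_pos; [apply Rabs_pos|]. left; apply Rinv_0_lt_compat; lra. }
  split; [lra|]. intros x Hx.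
  assert (Hx1 : T <= rin * x).
  { assert (rin * (1 + Rabs T / rin) = rin + Rabs T) by (field; lra).
    pose proof (Rle_abs T). nra. }
  pose proof (H (rin * x) Hx1) as Y1. pose proof (H (rout * x) ltac:(nra)) as Y2.
  unfold phase_gap.
  replace (theta (rout * x) - theta (rin * x) - (rout - rin) * x) with
    ((theta (rout * x) - rout * x - l) - (theta (rin * x) - rin * x - l)) by ring.
  eapply Rle_trans; [apply Rabs_triang|]. rewrite Rabs_Ropp.
  replace ((K / rout + K / rin) / x) with (K / (rout * x) + K / (rin * x)) by (field; lra).
  lra.
Qed.

Theorem theorem2p18 (rin rout delta nu : R)
    (hrin : 0 < rin) (hr : rin < rout) (hnu : Rabs delta <= nu) :
  (exists z : nat -> R,
     lists_positive_zeros (hfrak rin rout nu delta) (first_index nu delta) z) /\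
  (forall z : nat -> R,
     lists_positive_zeros (hfrak rin rout nu delta) (first_index nu delta) z ->
     exists (M : R) (K : nat), forall k : nat, (K <= k)%nat -> (0 < k)%nat ->
       Rabs (z k - PI / (rout - rin) * INR k) <= M * (1 / INR k)).
Proof.
  destruct (bessel_basis nu delta hnu) as (J' & Y' & SJ & SY & (w & Hw & EW) & eps & He & Hnz).
  set (J := besselJ nu) in *. set (Y := besselY nu) in *.
  destruct (bessel_solution_asymptotics nu J J' SJ) as (A & B & AJ).
  destruct (bessel_solution_asymptotics nu Y Y' SY) as (A' & B' & AY).
  pose proof (asymptotics_wronskian _ _ _ _ _ _ _ _ _ AJ AY EW) as Ew.
  (* The combinations with leading terms [cos t] and [sin t]. *)
  set (u1 := fun t => B' / w * J t + - B / w * Y t).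
  set (u1' := fun t => B' / w * J' t + - B / w * Y' t).
  set (u2 := fun t => - A' / w * J t + A / w * Y t).
  set (u2' := fun t => - A' / w * J' t + A / w * Y' t).
  assert (Hn : normalized_pair nu u1 u1' u2 u2').
  { split; [|split].
    - now apply bessel_solution_lin.
    - now apply bessel_solution_lin.
    - intros t Ht. transitivity ((A * B' - A' * B) / (w * w) * (t * (J t * Y' t - J' t * Y t))).
      + unfold u1, u1', u2, u2'. field. easy.
      + rewrite EW, Ew by easy. field. easy. }
  assert (A1 : bessel_asymptotics u1 u1' 1 0).
  { replace 1 with (B' / w * A + - B / w * A') by (rewrite <- Ew; field; lra).
    replace 0 with (B' / w * B + - B / w * B') by (field; easy).
    now apply bessel_asymptotics_lin. }
  assert (A2 : bessel_asymptotics u2 u2' 0 1).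
  { replace 1 with (- A' / w * B + A / w * B') by (rewrite <- Ew; field; lra).
    replace 0 with (- A' / w * A + A / w * A') by (field; easy).
    now apply bessel_asymptotics_lin. }
  destruct (phase_exists nu delta _ _ _ _ Hn) as [theta Hth].
  destruct (phase_asymptotics nu delta _ _ _ _ theta Hth A1 A2) as (l & T & K & _ & Hl).
  destruct (phase_gap_asymptotics rin rout l T K theta (conj hrin hr) Hl) as (C & X0 & HX0 & HC).
  apply (phase_gap_zeros _ (phase_gap rin rout theta)
    (fun x => rout * phase_speed nu delta u1 u1' u2 u2' (rout * x)
              - rin * phase_speed nu delta u1 u1' u2 u2' (rin * x)) _ _ C X0).
  - intros x Hx. assert (Ha : 0 < rin * x) by nra. assert (Hb : 0 < rout * x) by nra.
    unfold phase_gap.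
    rewrite <- (robin_det_phase nu delta _ _ _ _ _ _ theta Hn Hth Ha Hb).
    unfold hfrak, jd, yd. fold J Y.
    rewrite !(Derive_Rpower_mult delta _ J J') by (try apply SJ; easy).
    rewrite !(Derive_Rpower_mult delta _ Y Y') by (try apply SY; easy).
    set (a := rin * x) in *. set (b := rout * x) in *.
    (* The change of basis has determinant [(A B' - A' B) / w^2 = 1 / w], whence the factor [w]; the
       minus sign reflects the opposite order of the two radii in [hfrak]. *)
    set (c := - (Rpower a (- delta) * Rpower b (- delta) * w)).
    assert (Hc : c <> 0).
    { unfold c. apply Ropp_neq_0_compat.
      repeat apply Rmult_integral_contrapositive_currified; [..|easy];
        apply Rgt_not_eq, exp_pos. }
    assert (Ed : robin delta u1 u1' a * robin delta u2 u2' b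
      - robin delta u1 u1' b * robin delta u2 u2' a =
      (A * B' - A' * B) / (w * w) * (robin delta J J' a * robin delta Y Y' b
       - robin delta J J' b * robin delta Y Y' a)).
    { unfold robin, u1, u1', u2, u2'. field. repeat split; lra. }
    rewrite Ew in Ed.
    match goal with |- ?h = 0 <-> ?d = 0 => assert (Eh : h = c * d) end.
    { rewrite Ed. unfold c. field. easy. }
    rewrite Eh. split; intros E; [|rewrite E; ring].
    now destruct (Rmult_integral _ _ E).
  - intros x Hx. now apply is_derive_phase_gap.
  - intros x Hx Hs. now apply phase_gap_increasing_at_zero with theta.
  (* Inverting the change of basis gives [J = A u1 + B u2], so the combination that does not vanish
     near 0 is the Robin derivative of J. *)
  - apply (phase_gap_near_0 nu delta rin rout eps A B u1 u1' u2 u2'); try easy.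
    intros t Ht. replace (A * robin delta u1 u1' t + B * robin delta u2 u2' t)
      with (J' t - delta / t * J t); [now apply Hnz|].
    transitivity ((A * B' - A' * B) / w * robin delta J J' t).
    + rewrite Ew. unfold robin. field. lra.
    + unfold robin, u1, u1', u2, u2'. field. lra.
  - lra.
  - easy.
  - easy.
Qed.
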